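(* Let $E,A\in\mathbb{R}^{c\times n}$, $B\in\mathbb{R}^{c\times m}$, let $Q\in\mathbb{R}^{n\times n}$, $R\in\mathbb{R}^{m\times m}$, $Q_0\in\mathbb{R}^{c\times c}$ be symmetric with $Q>0$, $R>0$, $Q_0\ge 0$, and let $z\in\mathcal{V}(E,A,B)$. Let $(A_l,B_l,C_l,D_l)$ be an ODE-LTI associated with the DAE-LTI $\frac{d(Ex)}{dt}=Ax+Bu$, let $(A_g,B_g,C_g,D_g)$ be a corresponding stabilizable associated ODE-LTI with state map $\mathcal{M}_g$, let $P>0$ be the unique symmetric positive definite solution of the algebraic Riccati equation $$0=PA_g+A_g^TP-K^T(D_g^TSD_g)K+C_g^TSC_g,\qquad S=\mathrm{diag}(Q,R),$$ where $K=(D_g^TSD_g)^{-1}(B_g^TP+D_g^TSC_g)$ if $D_l\neq 0$ and $K=0$ if $D_l=0$. Then the following are equivalent: (i) the infinite horizon optimal control problem is solvable for $z$; (ii) the DAE-LTI is behaviorally stabilizable from $z$; (iii) $J_\infty^*=\limsup_{t\to\infty}\inf_{(x,u)\in\mathscr{D}_z(t)}J_t(x,u)<+\infty$. If these conditions hold, then the pair $(x^*,u^* )$ defined on $[0,+\infty)$ by $$\dot v^*=(A_g-B_gK)v^*,\quad v^*(0)=\mathcal{M}_g z,\quad \begin{bmatrix}x^*\\ u^*\end{bmatrix}=(C_g-D_gK)v^*$$ is a solution of the infinite horizon optimal control problem for $z$, and $$J_\infty^*=J_\infty(x^*,u^* )=(\mathcal{M}_gz)^TP\,\mathcal{M}_gz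 .$$ Moreover $u^*=K_fx^*$, where $K_f=(C_u-D_uK)\mathcal{M}_gE$ and $C_u,D_u$ are the matrices formed by the last $m$ rows of $C_g,D_g$. Furthermore, with $$K_1=(C_g-D_gK)\mathcal{M}_gE-\begin{bmatrix}I_n\\0\end{bmatrix}\in\mathbb{R}^{(n+m)\times n},\qquad K_2=\begin{bmatrix}0\\-I_m\end{bmatrix}\in\mathbb{R}^{(n+m)\times m},$$ $(x^*,u^* )$ is a solution on $[0,+\infty)$ of $$\frac{d(Ex(t))}{dt}=Ax(t)+Bu(t),\qquad K_1x(t)+K_2u(t)=0 \text{ (a.e.)}$$ with $Ex^*(0)=z$, and every solution $(x,u)$ of this system on $[0,+\infty)$ with $Ex(0)=z$ satisfies $(x,u)=(x^*,u^* )$ a.e.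
   Context: Throughout, matrices are real; $F^+$ is the Moore–Penrose pseudoinverse of $F$. An interval is a set $I\subseteq\mathbb{R}$ of the form $\mathbb{R}$, $[a,+\infty)$, $(-\infty,a]$ or $[a,b]$ with $a<b$. $L^1_{loc}(I,\mathbb{R}^q)$ is the set of measurable $f:I\to\mathbb{R}^q$ that are Lebesgue integrable on every compact interval $K\subseteq I$. $AC(I,\mathbb{R}^q)$ is the set of absolutely continuous functions $I\to\mathbb{R}^q$ (for unbounded $I$: absolutely continuous on every compact subinterval). A solution of the DAE-LTI $\frac{d(Ex(t))}{dt}=Ax(t)+Bu(t)$ on $I$ is a pair $(x,u)\in L^1_{loc}(I,\mathbb{R}^n)\times L^1_{loc}(I,\mathbb{R}^m)$ such that $Ex$ is absolutely continuous and $Ex(t)=Ex(t_0)+\int_{t_0}^t(Ax(s)+Bu(s))\,ds$ for all $t_0,t\in I$, $t\ge t_0$. $\mathcal{B}_I(E,A,B)$ is the set of all solutions on $I$, viewed also as a subset of $L^1_{loc}(I,\mathbb{R}^{n+m})$ by stacking. A vector $z\in\mathbb{R}^c$ is differentiably consistent if there is a solution $(x,u)$ on some interval $I\ni 0$ with $Ex(0)=z$; $\mathcal{V}(E,A,B)$ is the set of all such $z$. An ODE-LTI $(\widetilde A,G,\widetilde C,\widetilde D)$ is the system $\dot p=\widetilde Ap+Gw$, $y=\widetilde Cp+\widetilde Dw$ with state $p$ (in $\mathbb{R}^r$), input $w$ (in $\mathbb{R}^s$), output $y$ (in $\mathbb{R}^q$). It is a realization of $\mathcal{B}\subseteq L^1_{loc}(I,\mathbb{R}^q)$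 if (1) for every $y\in\mathcal{B}$ there exist $p\in AC(I,\mathbb{R}^r)$, $w\in L^1_{loc}(I,\mathbb{R}^s)$ with $\dot p=\widetilde Ap+Gw$ a.e. and $y=\widetilde Cp+\widetilde Dw$ a.e.; and (2) whenever $(p,w)\in AC(I,\mathbb{R}^r)\times L^1_{loc}(I,\mathbb{R}^s)$ satisfies $\dot p=\widetilde Ap+Gw$ a.e., there is $y\in\mathcal{B}$ with $y=\widetilde Cp+\widetilde Dw$ a.e. An ODE-LTI $(A_l,B_l,C_l,D_l)$ with $A_l\in\mathbb{R}^{\hat n\times\hat n}$, $B_l\in\mathbb{R}^{\hat n\times k}$, $C_l\in\mathbb{R}^{(n+m)\times\hat n}$, $D_l\in\mathbb{R}^{(n+m)\times k}$, $\hat n\le n$ ($\hat n=0$ allowed), is associated with the DAE-LTI if: (1) either $D_l=0$, $B_l=0$ and $k=1$, or $\mathrm{Rank}\,D_l=k$; (2) if $C_s,D_s$ denote the matrices formed by the first $n$ rows of $C_l,D_l$, then $ED_s=0$ and $\mathrm{Rank}\,EC_s=\hat n$; (3) $(A_l,B_l,C_l,D_l)$ is a realization of $\mathcal{B}_I(E,A,B)$ for every interval $I$. Its state map is $\mathcal{M}=(EC_s)^+$. Stabilizable associated ODE-LTI: let $\mathcal{V}_g$ be the stabilizability subspace of $(A_l,B_l,C_l,D_l)$, i.e. the set of $p_0\in\mathbb{R}^{\hat n}$ for which there is an input $g\in L^1_{loc}([0,+\infty),\mathbb{R}^k)$ such that the solution of $\dot p=A_lp+B_lg$, $p(0)=p_0$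 satisfies $\lim_{t\to\infty}p(t)=0$. It is $A_l$-invariant and contains $\mathrm{im}\,B_l$. Let $l=\dim\mathcal{V}_g$ and let $T$ be a nonsingular matrix with $T(\mathcal{V}_g)=\mathbb{R}^l\times\{0\}$, so that $TA_lT^{-1}=\begin{bmatrix}A_g&\star\\0&\star\end{bmatrix}$, $TB_l=\begin{bmatrix}B_g\\0\end{bmatrix}$, $C_lT^{-1}=\begin{bmatrix}C_g&\star\end{bmatrix}$ with $A_g\in\mathbb{R}^{l\times l}$, $B_g\in\mathbb{R}^{l\times k}$, $C_g\in\mathbb{R}^{(n+m)\times l}$; put $D_g=D_l$. Then $(A_g,B_g,C_g,D_g)$ is called a stabilizable ODE-LTI associated with the DAE-LTI and $\mathcal{M}_g=\begin{bmatrix}I_l&0\end{bmatrix}T\mathcal{M}$ its state map. The Riccati equation in the claim has a unique symmetric solution $P>0$. Control problem: for $t_1>0$, $\mathscr{D}_z(t_1)$ is the set of solutions $(x,u)$ of the DAE-LTI on $[0,t_1]$ with $Ex(0)=z$, and $\mathscr{D}_z(\infty)$ is the set of solutions on $[0,+\infty)$ with $Ex(0)=z$. Put $$J_{t_1}(x,u)=x(t_1)^TE^TQ_0Ex(t_1)+\int_0^{t_1}\big(x(s)^TQx(s)+u(s)^TRu(s)\big)ds\in[0,+\infty]$$ (for $(x,u)$ defined on an interval containing $[0,t_1]$), and $J_\infty(x,u)=\limsup_{t\to\infty}J_t(x,u)$ for $(x,u)\in\mathscr{D}_z(\infty)$. Let $J_\infty^*=\limsup_{t_1\to\infty}\inf_{(x,u)\in\mathscr{D}_z(t_1)}J_{t_1}(x,u)$.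 The infinite horizon optimal control problem for $z$ is to find $(x^*,u^* )\in\mathscr{D}_z(\infty)$ with $J_\infty(x^*,u^* )=J_\infty^*<+\infty$; such a pair is called a solution of the problem, and the problem is solvable if one exists. The DAE-LTI is behaviorally stabilizable from $z\in\mathcal{V}(E,A,B)$ if there is $(x,u)\in\mathscr{D}_z(\infty)$ with $\lim_{t\to\infty}x(t)=0$. *)

(* Defs.v *)
From HB Require Import structures.
From mathcomp Require Import all_boot all_order all_algebra.
From mathcomp Require Import all_classical all_reals all_analysis.

Set Implicit Arguments.
Unset Strict Implicit.
Unset Printing Implicit Defensive.

Import Order.TTheory GRing.Theory Num.Theory.
Import numFieldTopology.Exports numFieldNormedType.Exports.

Local Open Scope classical_set_scope.
Local Open Scope ring_scope.

Definition quad (R : realType) (d : nat) (M : 'M[R]_d) (v : 'cV[R]_d) : R :=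
  (v^T *m M *m v) 0 0.

Definition posdefmx (R : realType) (d : nat) (M : 'M[R]_d) : Prop :=
  forall v : 'cV[R]_d, v != 0 -> 0 < quad M v.

Definition possemidefmx (R : realType) (d : nat) (M : 'M[R]_d) : Prop :=
  forall v : 'cV[R]_d, 0 <= quad M v.

(* The library's [pinvmx] is only some generalized inverse, so it cannot serve
   as the Moore-Penrose pseudoinverse. *)
Definition penrose (R : realType) (p q : nat) (F : 'M[R]_(p, q))
    (X : 'M[R]_(q, p)) : Prop :=
  [/\ F *m X *m F = F, X *m F *m X = X,
      (F *m X)^T = F *m X & (X *m F)^T = X *m F].

Definition mp_pinv (R : realType) (p q : nat) (F : 'M[R]_(p, q)) :
    'M[R]_(q, p) :=
  xget 0 [set X | penrose F X].

Lemma penrose_uniq (R : realType) (p q : nat) (F : 'M[R]_(p, q))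
    (X Y : 'M[R]_(q, p)) : penrose F X -> penrose F Y -> X = Y.
Proof.
move=> [FXF XFX FXT XFT] [FYF YFY FYT YFT].
have eFX : F *m X = F *m Y.
  have h : F *m X = F *m Y *m (F *m X) by rewrite !mulmxA FYF.
  by rewrite -FXT h trmx_mul FXT FYT !mulmxA FXF.
have eXF : X *m F = Y *m F.
  have h : X *m F = X *m F *m (Y *m F) by rewrite -!mulmxA (mulmxA F) FYF.
  by rewrite -XFT h trmx_mul XFT YFT -!mulmxA (mulmxA F) FXF.
by rewrite -XFX eXF -mulmxA eFX mulmxA YFY.
Qed.

Lemma gram_unitmx (R : realType) (p q : nat) (F : 'M[R]_(p, q)) :
  row_free F -> F *m F^T \in unitmx.
Proof.
move=> Ffree; rewrite -row_free_unit -kermx_eq0; apply/eqP/row_matrixP => i.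
rewrite row0; set v := row i _.
have v0 : v *m (F *m F^T) = 0 by rewrite -row_mul mulmx_ker row0.
apply: (row_free_inj Ffree); rewrite mul0mx.
have h : \sum_j (v *m F) 0 j ^+ 2 = 0.
  have : ((v *m F) *m (v *m F)^T) 0 0 = 0.
    by rewrite trmx_mul !mulmxA -(mulmxA v) v0 mul0mx mxE.
  rewrite mxE => h0; rewrite -[RHS]h0; apply: eq_bigr => j _.
  by rewrite [(_^T) _ _]mxE expr2.
apply/rowP => j; rewrite [RHS]mxE; apply/eqP; rewrite -sqrf_eq0; apply/eqP.
by apply: (psumr_eq0P _ h) => // k _; exact: sqr_ge0.
Qed.

Lemma penrose_full_rank_factorization (R : realType) (p r q : nat)
    (C : 'M[R]_(p, r)) (W : 'M[R]_(r, q)) : row_free C^T -> row_free W ->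
  penrose (C *m W)
    (W^T *m invmx (W *m W^T) *m (invmx (C^T *m C) *m C^T)).
Proof.
move=> /gram_unitmx; rewrite trmxK => Cu /gram_unitmx Wu.
set X := _ *m (_ *m _).
have eFX : C *m W *m X = C *m invmx (C^T *m C) *m C^T.
  rewrite /X !mulmxA -(mulmxA C W) -(mulmxA C (W *m W^T)).
  by rewrite mulmxV // mulmx1.
have eXF : X *m (C *m W) = W^T *m invmx (W *m W^T) *m W.
  rewrite /X -!mulmxA (mulmxA C^T) (mulmxA _ (C^T *m C)).
  by rewrite mulVmx // mul1mx.
split.
- rewrite eFX !mulmxA -(mulmxA _ C^T) -(mulmxA C) mulVmx //.
  by rewrite mulmx1.
- rewrite eXF /X !mulmxA -(mulmxA _ W) -(mulmxA W^T) mulVmx //.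
  by rewrite mulmx1.
- by rewrite eFX !trmx_mul trmxK trmx_inv trmx_mul trmxK mulmxA.
- by rewrite eXF !trmx_mul trmxK trmx_inv trmx_mul trmxK mulmxA.
Qed.

Lemma mp_pinvP (R : realType) (p q : nat) (F : 'M[R]_(p, q)) :
  penrose F (mp_pinv F).
Proof.
have Cfree : row_free (col_base F)^T.
  by rewrite /row_free mxrank_tr; exact: col_base_full.
have := penrose_full_rank_factorization Cfree (row_base_free F).
by rewrite mulmx_base => FX; apply: (xgetPex 0); eexists; exact: FX.
Qed.

Inductive time_interval (R : realType) : set R -> Prop :=
| TimeLine : time_interval setT
| TimeFrom a : time_interval `[a, +oo[
| TimeUntil b : time_interval `]-oo, b]
| TimeSegment a b : a < b -> time_interval `[a, b].

(* Functions on a time interval I are represented by total functions on R; every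
   notion below that takes I as an argument only depends on the values on I.
   Vector-valued notions are taken componentwise; measurability is with respect
   to the Borel sigma-algebra. *)
Definition L1loc (R : realType) (I : set R) (q : nat) (f : R -> 'cV[R]_q) :
    Prop :=
  forall i,
    measurable_fun I (fun t => f t i 0) /\
    forall a b, `[a, b] `<=` I ->
      (@lebesgue_measure R).-integrable `[a, b] (fun t => (f t i 0)%:E).

(* The N intervals [s k, t k] are non-overlapping. *)
Definition abs_continuous_segment (R : realType) (a b : R) (f : R -> R) :
    Prop :=
  forall e : R, 0 < e -> exists2 d : R, 0 < d &
    forall (N : nat) (s t : 'I_N -> R),
      (forall k, a <= s k /\ s k <= t k /\ t k <= b) ->
      (forall j k, j != k -> t j <= s k \/ t k <= s j) ->
      \sum_(k < N) (t k - s k) < d ->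
      \sum_(k < N) `|f (t k) - f (s k)| < e.

Definition AC (R : realType) (I : set R) (q : nat) (f : R -> 'cV[R]_q) : Prop :=
  forall i a b, `[a, b] `<=` I ->
    abs_continuous_segment a b (fun t => f t i 0).

Definition vintegral (R : realType) (q : nat) (a b : R) (f : R -> 'cV[R]_q) :
    'cV[R]_q :=
  \col_i \int[@lebesgue_measure R]_(s in `[a, b]) f s i 0.

Definition eq_ae (R : realType) (I : set R) (q : nat) (f g : R -> 'cV[R]_q) :
    Prop :=
  {ae @lebesgue_measure R, forall t, I t -> f t = g t}.

Definition has_derivative_ae (R : realType) (I : set R) (q : nat)
    (p f : R -> 'cV[R]_q) : Prop :=
  {ae @lebesgue_measure R, forall t, I t ->
    forall i, is_derive t (1 : R) (fun s => p s i 0) (f t i 0)}.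

Definition tends_to_zero (R : realType) (q : nat) (f : R -> 'cV[R]_q) : Prop :=
  forall i, f t i 0 @[t --> +oo] --> (0 : R).

Definition dae_solution (R : realType) (c n m : nat) (I : set R)
    (E A : 'M[R]_(c, n)) (B : 'M[R]_(c, m))
    (x : R -> 'cV[R]_n) (u : R -> 'cV[R]_m) : Prop :=
  [/\ L1loc I x, L1loc I u, AC I (fun t => E *m x t) &
      forall t0 t, I t0 -> I t -> t0 <= t ->
        E *m x t = E *m x t0 + vintegral t0 t (fun s => A *m x s + B *m u s)].

Definition dae_behavior (R : realType) (c n m : nat) (I : set R)
    (E A : 'M[R]_(c, n)) (B : 'M[R]_(c, m)) : set (R -> 'cV[R]_(n + m)) :=
  [set y | dae_solution I E A B (fun t => usubmx (y t)) (fun t => dsubmx (y t))].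

Definition dae_solution_from (R : realType) (c n m : nat) (I : set R)
    (E A : 'M[R]_(c, n)) (B : 'M[R]_(c, m)) (z : 'cV[R]_c)
    (x : R -> 'cV[R]_n) (u : R -> 'cV[R]_m) : Prop :=
  dae_solution I E A B x u /\ E *m x 0 = z.

Definition diff_consistent (R : realType) (c n m : nat)
    (E A : 'M[R]_(c, n)) (B : 'M[R]_(c, m)) : set 'cV[R]_c :=
  [set z | exists (I : set R) x u,
    [/\ time_interval I, I 0 & dae_solution_from I E A B z x u]].

Definition behaviorally_stabilizable (R : realType) (c n m : nat)
    (E A : 'M[R]_(c, n)) (B : 'M[R]_(c, m)) (z : 'cV[R]_c) : Prop :=
  exists x u, dae_solution_from `[0, +oo[ E A B z x u /\ tends_to_zero x.

Definition ode_solution (R : realType) (r s : nat) (I : set R)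
    (A : 'M[R]_r) (G : 'M[R]_(r, s))
    (p : R -> 'cV[R]_r) (w : R -> 'cV[R]_s) : Prop :=
  [/\ AC I p, L1loc I w &
      has_derivative_ae I p (fun t => A *m p t + G *m w t)].

Definition realization (R : realType) (r s q : nat) (I : set R)
    (A : 'M[R]_r) (G : 'M[R]_(r, s)) (C : 'M[R]_(q, r)) (D : 'M[R]_(q, s))
    (Beh : set (R -> 'cV[R]_q)) : Prop :=
  (forall y, Beh y -> exists p w,
     ode_solution I A G p w /\ eq_ae I y (fun t => C *m p t + D *m w t)) /\
  (forall p w, ode_solution I A G p w -> exists y,
     Beh y /\ eq_ae I y (fun t => C *m p t + D *m w t)).

Definition associated_ode (R : realType) (c n m nh k : nat)
    (E A : 'M[R]_(c, n)) (B : 'M[R]_(c, m))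
    (Al : 'M[R]_nh) (Bl : 'M[R]_(nh, k))
    (Cl : 'M[R]_(n + m, nh)) (Dl : 'M[R]_(n + m, k)) : Prop :=
  [/\ (nh <= n)%N,
      [/\ Dl = 0, Bl = 0 & k = 1%N] \/ \rank Dl = k,
      E *m usubmx Dl = 0,
      \rank (E *m usubmx Cl) = nh &
      forall I : set R, time_interval I ->
        realization I Al Bl Cl Dl (dae_behavior I E A B)].

Definition state_map (R : realType) (c n m nh : nat) (E : 'M[R]_(c, n))
    (Cl : 'M[R]_(n + m, nh)) : 'M[R]_(nh, c) :=
  mp_pinv (E *m usubmx Cl).

Definition stabilizability_subspace (R : realType) (nh k : nat)
    (Al : 'M[R]_nh) (Bl : 'M[R]_(nh, k)) : set 'cV[R]_nh :=
  [set p0 | exists g p,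
    [/\ ode_solution `[0, +oo[ Al Bl p g, p 0 = p0 & tends_to_zero p]].

(* The state dimension of (Al, Bl, Cl, Dl) is written l + r, where l is the
   dimension of the stabilizability subspace; the first equation forces l. *)
Definition stabilizable_ode (R : realType) (l r k q : nat)
    (Al : 'M[R]_(l + r)) (Bl : 'M[R]_(l + r, k))
    (Cl : 'M[R]_(q, l + r)) (Dl : 'M[R]_(q, k)) (T : 'M[R]_(l + r))
    (Ag : 'M[R]_l) (Bg : 'M[R]_(l, k)) (Cg : 'M[R]_(q, l)) (Dg : 'M[R]_(q, k)) :
    Prop :=
  [/\ T \in unitmx,
      [set T *m p | p in stabilizability_subspace Al Bl] =
        [set v | dsubmx v = 0],
      exists A12 A22, T *m Al *m invmx T = block_mx Ag A12 0 A22,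
      T *m Bl = col_mx Bg 0 &
      (exists C2, Cl *m invmx T = row_mx Cg C2) /\ Dg = Dl].

Definition stabilizable_state_map (R : realType) (c n m l r : nat)
    (E : 'M[R]_(c, n)) (Cl : 'M[R]_(n + m, l + r)) (T : 'M[R]_(l + r)) :
    'M[R]_(l, c) :=
  row_mx 1%:M 0 *m T *m state_map E Cl.

Definition riccati_gain (R : realType) (l k q : nat) (S : 'M[R]_q)
    (Bg : 'M[R]_(l, k)) (Cg : 'M[R]_(q, l)) (Dg : 'M[R]_(q, k)) (P : 'M[R]_l) :
    'M[R]_(k, l) :=
  if Dg == 0 then 0
  else invmx (Dg^T *m S *m Dg) *m (Bg^T *m P + Dg^T *m S *m Cg).

Definition riccati_equation (R : realType) (l k q : nat) (S : 'M[R]_q)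
    (Ag : 'M[R]_l) (Bg : 'M[R]_(l, k)) (Cg : 'M[R]_(q, l)) (Dg : 'M[R]_(q, k))
    (P : 'M[R]_l) : Prop :=
  let K := riccati_gain S Bg Cg Dg P in
  0 = P *m Ag + Ag^T *m P - K^T *m (Dg^T *m S *m Dg) *m K + Cg^T *m S *m Cg.

(* A solution of v' = F v, v(0) = v0 in the Caratheodory sense; by continuity it
   is the classical one. Its values at negative times are irrelevant. *)
Definition free_trajectory (R : realType) (l : nat) (F : 'M[R]_l)
    (v0 : 'cV[R]_l) (v : R -> 'cV[R]_l) : Prop :=
  [/\ AC `[0, +oo[ v, has_derivative_ae `[0, +oo[ v (fun t => F *m v t) &
      v 0 = v0].

Section cost.
Local Open Scope ereal_scope.

Definition cost (R : realType) (c n m : nat) (E : 'M[R]_(c, n))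
    (Q : 'M[R]_n) (Ru : 'M[R]_m) (Q0 : 'M[R]_c) (t1 : R)
    (x : R -> 'cV[R]_n) (u : R -> 'cV[R]_m) : \bar R :=
  (quad Q0 (E *m x t1))%:E +
  \int[@lebesgue_measure R]_(s in `[0%R, t1])
     (quad Q (x s) + quad Ru (u s))%:E.

Definition cost_infinite (R : realType) (c n m : nat) (E : 'M[R]_(c, n))
    (Q : 'M[R]_n) (Ru : 'M[R]_m) (Q0 : 'M[R]_c)
    (x : R -> 'cV[R]_n) (u : R -> 'cV[R]_m) : \bar R :=
  limf_esup (fun t => cost E Q Ru Q0 t x u) (pinfty_nbhs R).

Definition optimal_cost (R : realType) (c n m : nat)
    (E A : 'M[R]_(c, n)) (B : 'M[R]_(c, m))
    (Q : 'M[R]_n) (Ru : 'M[R]_m) (Q0 : 'M[R]_c) (z : 'cV[R]_c) (t1 : R) :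
    \bar R :=
  ereal_inf [set cost E Q Ru Q0 t1 xu.1 xu.2
            | xu in [set xu | dae_solution_from `[0%R, t1] E A B z xu.1 xu.2]].

Definition optimal_cost_infinite (R : realType) (c n m : nat)
    (E A : 'M[R]_(c, n)) (B : 'M[R]_(c, m))
    (Q : 'M[R]_n) (Ru : 'M[R]_m) (Q0 : 'M[R]_c) (z : 'cV[R]_c) : \bar R :=
  limf_esup (optimal_cost E A B Q Ru Q0 z) (pinfty_nbhs R).

Definition infinite_horizon_solution (R : realType) (c n m : nat)
    (E A : 'M[R]_(c, n)) (B : 'M[R]_(c, m))
    (Q : 'M[R]_n) (Ru : 'M[R]_m) (Q0 : 'M[R]_c) (z : 'cV[R]_c)
    (x : R -> 'cV[R]_n) (u : R -> 'cV[R]_m) : Prop :=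
  [/\ dae_solution_from `[0%R, +oo[ E A B z x u,
      cost_infinite E Q Ru Q0 x u = optimal_cost_infinite E A B Q Ru Q0 z &
      optimal_cost_infinite E A B Q Ru Q0 z < +oo].

Definition infinite_horizon_solvable (R : realType) (c n m : nat)
    (E A : 'M[R]_(c, n)) (B : 'M[R]_(c, m))
    (Q : 'M[R]_n) (Ru : 'M[R]_m) (Q0 : 'M[R]_c) (z : 'cV[R]_c) : Prop :=
  exists x u, infinite_horizon_solution E A B Q Ru Q0 z x u.

End cost.

Definition controlled_solution_from (R : realType) (c n m q : nat)
    (E A : 'M[R]_(c, n)) (B : 'M[R]_(c, m))
    (K1 : 'M[R]_(q, n)) (K2 : 'M[R]_(q, m)) (z : 'cV[R]_c)
    (x : R -> 'cV[R]_n) (u : R -> 'cV[R]_m) : Prop :=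
  dae_solution_from `[0, +oo[ E A B z x u /\
  eq_ae `[0, +oo[ (fun t => K1 *m x t + K2 *m u t) (fun=> 0).

(* Main.v *)
From mathcomp Require Import all_boot all_order all_algebra.
From mathcomp Require Import all_classical all_reals all_analysis.
From mathcomp Require Import measurable_realfun ring lra.
Require Import Defs.

Set Implicit Arguments.
Unset Strict Implicit.
Unset Printing Implicit Defensive.

Import Order.TTheory GRing.Theory Num.Theory.
Import numFieldTopology.Exports numFieldNormedType.Exports.

Local Open Scope classical_set_scope.
Local Open Scope ring_scope.

(** Write [M] for the state map of the associated system, [Mg] for that of its
    stabilizable part and [Vg] for the stabilizability subspace. A solution
    [(x, u)] of the differential-algebraic equation is, almost everywhere, the
    output [y] of the associated system for a state [p] with [p = M (E x)] at
    every time ([dae_state]). In the coordinates given by [T] the state splits as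
    [(v, q)] with [v' = Ag v + A12 q + Bg w], [q' = A22 q], and
    [y = Cg v + C2 q + Dg w]. All three conditions are shown to be equivalent to
    [M z] lying in [Vg], that is, to [q (0) = 0], together with
    [z = E (Cs (M z))], where [Cs] is the upper part of [Cl].

    Put [V = v^T P v]. By the Riccati equation, along [q = 0] the sum of [V'] and
    of the running cost [y^T S y] is a nonnegative quadratic form in [w + K v]
    ([completion_of_squares]). Moreover [y^T S y] dominates a multiple of
    [|v|^2 + |q|^2], because the state is a linear function of [y]
    ([cost_coercive]). Three facts follow.

    - Closed loop. For [w = - K v] the running cost is exactly [- V'], so the
      cost on [0, t] is [V (0) - V (t)] plus a terminal term
      ([closed_loop_cost]). In particular [|v|^2] is integrable, and a
      square-integrable solution of a linear system tends to zero
      ([linear_ode_L2_tends_to_zero]); hence the cost tends to [V (0)].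

    - Lower bound. If [q = 0] and the cost on a long segment [0, b] is less than
      [V (0)], then [V (tau)] is small for some [tau] in it, and the cost on
      [0, tau] is at least [V (0) - V (tau)] ([cost_lower_bound]). So the optimal
      cost on [0, b] is asymptotically at least [V (0)], without any recourse to
      the differential Riccati equation.

    - Necessity. If the optimal costs stay bounded, then so does the integral of
      [|q|^2], as [q] depends only on [q (0)]. Applying [w = - K v], with [q] as a
      square-integrable perturbation, makes [(v, q)] square integrable, hence
      convergent to zero; so the initial state was stabilizable and [q (0) = 0]
      ([unstable_part_zero], [finite_cost_stabilizable]).

    States are only absolutely continuous. Every differential inequality above is
    integrated by means of one theorem: an absolutely continuous function whose
    derivative is nonnegative almost everywhere is nondecreasing
    ([ac_nondecreasing]). *)

(** * Absolutely continuous functions *)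

Section AbsoluteContinuity.
Context {R : realType}.
Implicit Types (a b : R) (f g : R -> R).
Notation mu := (@lebesgue_measure R).

Lemma ac_subsegment a b a' b' f : a <= a' -> b' <= b ->
  abs_continuous_segment a b f -> abs_continuous_segment a' b' f.
Proof.
move=> aa bb acf e /acf[d d0 H]; exists d => // N s t st dis sd.
by apply: H => // k; have [h1 [h2 h3]] := st k; split; [lra|split; lra].
Qed.

Lemma ac_unif_continuous a b f : abs_continuous_segment a b f ->
  forall e, 0 < e -> exists2 d, 0 < d &
    forall x y, a <= x <= b -> a <= y <= b -> `|x - y| < d -> `|f x - f y| < e.
Proof.
move=> acf e /acf[d d0 H]; exists d => //.
have aux x y : a <= x <= b -> a <= y <= b -> x <= y ->
    `|x - y| < d -> `|f x - f y| < e.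
  move=> /andP[ax xb] /andP[ay yb] xy xyd.
  have := H 1%N (fun=> x) (fun=> y); rewrite !big_ord1 distrC; apply.
  - by move=> _.
  - by move=> j k; rewrite !ord1 eqxx.
  - by move: xyd; rewrite distrC ger0_norm ?subr_ge0.
move=> x y xab yab xyd; have [xy|yx] := leP x y; first exact: aux.
by rewrite distrC; apply: aux => //; [exact: ltW|rewrite distrC].
Qed.

Lemma ac_continuous a b f : abs_continuous_segment a b f ->
  {within `[a, b], continuous f}.
Proof.
move=> acf; apply/subspace_continuousP => x; rewrite /= in_itv /= => xab.
apply/cvgrPdist_lt => e e0; have [d d0 H] := ac_unif_continuous acf e0.
rewrite near_withinE; near=> y => yab; apply: H => //.
Unshelve. all: by end_near. Qed.

Lemma ac_bounded a b f : abs_continuous_segment a b f ->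
  exists2 M, 0 < M & forall x, a <= x <= b -> `|f x| <= M.
Proof.
move=> acf; have [ab|ba] := leP a b; last first.
  by exists 1 => // x xab; exfalso; lra.
have cf := ac_continuous acf.
have cn : {within `[a, b], continuous (fun x => `|f x|)}.
  move=> x; apply: (@continuous_comp _ _ _ (f : subspace _ -> _)).
    exact: cf.
  exact: norm_continuous.
have [c _ H] := EVT_max ab cn.
exists (`|f c| + 1); first by rewrite ltr_pwDr.
by move=> x xab; rewrite (le_trans (H x _)) ?in_itv ?lerDl.
Qed.

Lemma ac_lipschitz a b f (k : R) :
  (forall x y, a <= x -> x <= y -> y <= b -> `|f y - f x| <= k * (y - x)) ->
  abs_continuous_segment a b f.
Proof.
move=> lip e e0; exists (e / (`|k| + 1)).
  by rewrite divr_gt0 // ltr_pwDr.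
move=> N s t st _; rewrite ltr_pdivlMr ?ltr_pwDr // => sd.
apply: le_lt_trans sd; rewrite mulr_suml; apply: ler_sum => i _.
have [h1 [h2 h3]] := st i.
apply: (le_trans (lip _ _ h1 h2 h3)); rewrite mulrC ler_wpM2l ?subr_ge0 //.
by rewrite (le_trans (ler_norm k)) // lerDl.
Qed.

Lemma ac_cst a b (c : R) : abs_continuous_segment a b (fun=> c).
Proof.
by apply: (@ac_lipschitz _ _ _ 0) => x y _ _ _; rewrite subrr normr0 mul0r.
Qed.

Lemma ac_id a b : abs_continuous_segment a b id.
Proof.
by apply: (@ac_lipschitz _ _ _ 1) => x y _ xy _; rewrite mul1r ger0_norm ?subr_ge0.
Qed.

Lemma acD a b f g : abs_continuous_segment a b f ->
  abs_continuous_segment a b g -> abs_continuous_segment a b (fun t => f t + g t).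
Proof.
move=> acf acg e e0; have e20 : 0 < e / 2 by rewrite divr_gt0.
have [d1 d10 H1] := acf _ e20; have [d2 d20 H2] := acg _ e20.
exists (Num.min d1 d2); first by rewrite lt_min d10.
move=> N s t st dis; rewrite lt_min => /andP[sd1 sd2].
rewrite [ltRHS]splitr.
apply: le_lt_trans (ltrD (H1 _ _ _ st dis sd1) (H2 _ _ _ st dis sd2)).
rewrite -big_split /=; apply: ler_sum => i _.
by rewrite opprD addrACA ler_normD.
Qed.

Lemma acM a b f g : abs_continuous_segment a b f ->
  abs_continuous_segment a b g -> abs_continuous_segment a b (fun t => f t * g t).
Proof.
move=> acf acg e e0.
have [M1 M10 B1] := ac_bounded acf; have [M2 M20 B2] := ac_bounded acg.
have e1 : 0 < e / 2 / M2 by rewrite !divr_gt0.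
have e2 : 0 < e / 2 / M1 by rewrite !divr_gt0.
have [d1 d10 H1] := acf _ e1; have [d2 d20 H2] := acg _ e2.
exists (Num.min d1 d2); first by rewrite lt_min d10.
move=> N s t st dis; rewrite lt_min => /andP[sd1 sd2].
have := H1 _ _ _ st dis sd1; rewrite ltr_pdivlMr // => h1.
have := H2 _ _ _ st dis sd2; rewrite ltr_pdivlMr // => h2.
rewrite [ltRHS]splitr; apply: le_lt_trans (ltrD h1 h2).
rewrite !mulr_suml -big_split /=; apply: ler_sum => i _.
have [k1 [k2 k3]] := st i.
have -> : f (t i) * g (t i) - f (s i) * g (s i) =
  (f (t i) - f (s i)) * g (t i) + (g (t i) - g (s i)) * f (s i) by ring.
rewrite (le_trans (ler_normD _ _)) // !normrM lerD //.
  by rewrite ler_wpM2l // B2 // k3 andbT; lra.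
by rewrite ler_wpM2l // B1 // k1 /=; lra.
Qed.

Lemma acZ a b (c : R) f : abs_continuous_segment a b f ->
  abs_continuous_segment a b (fun t => c * f t).
Proof. by move=> acf; apply: acM => //; exact: ac_cst. Qed.

Lemma ac_sum a b n (F : 'I_n -> R -> R) :
  (forall i, abs_continuous_segment a b (F i)) ->
  abs_continuous_segment a b (fun t => \sum_i F i t).
Proof.
elim: n F => [|n IH] F acF.
  by under eq_fun do rewrite big_ord0; exact: ac_cst.
under eq_fun do rewrite big_ord_recl.
exact: (acD (acF ord0) (IH (fun i => F (lift ord0 i)) (fun i => acF _))).
Qed.

(** [reach U e1 f a x]: from [a] one gets to [x] by finitely many consecutive
    steps. The list [L], latest first, holds those contained in [U]; what is
    recorded of them is that their total length is at most the measure of the part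
    of [U] between [a] and [x]. Along the other steps [f] decreases at slope at
    most [e1]. *)
Let reach (U : set R) (e1 : R) f a x := exists L : seq (R * R),
  [/\ forall p, p \in L -> [/\ a <= p.1, p.1 <= p.2 & p.2 <= x],
      pairwise (fun p q : R * R => q.2 <= p.1) L,
      ((\sum_(p <- L) (p.2 - p.1))%:E <= mu (U `&` `[a, x[))%E &
      f a <= f x + e1 * (x - a) + \sum_(p <- L) `|f p.2 - f p.1|].

Let reach_step U e1 f a x y : 0 <= e1 -> measurable U -> a <= x -> x <= y ->
  `[x, y] `<=` U \/ f x <= f y + e1 * (y - x) ->
  reach U e1 f a x -> reach U e1 f a y.
Proof.
move=> e10 mU ax xy step [L [L1 L2 L3 L4]].
have sub : U `&` `[a, x[ `<=` U `&` `[a, y[.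
  move=> t [Ut]; rewrite /= !in_itv /= => /andP[h1 h2]; split=> //.
  by apply/andP; split=> //; lra.
have mUx z w : measurable (U `&` `[z, w[) by apply: measurableI.
case: step => step; last first.
  exists L; split => //.
  - by move=> p /L1[h1 h2 h3]; split => //; lra.
  - by apply: (le_trans L3); rewrite le_measure ?inE //; exact: mUx.
  - by lra.
exists ((x, y) :: L); split.
- move=> p; rewrite inE => /orP[/eqP -> //|/L1[h1 h2 h3]]; split => //; lra.
- rewrite /= L2 andbT; by apply/allP => p /L1 [_ _ h]; exact: h.
- rewrite big_cons /= EFinD.
  have -> : U `&` `[a, y[ = (`[x, y[%classic) `|` (U `&` `[a, x[).
    apply/seteqP; split => t /=.
      move=> [Ut]; rewrite !in_itv /= => /andP[h1 h2].
      have [tx|xt] := ltP t x; first by right; rewrite h1.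
      by left; rewrite h2.
    rewrite !in_itv /= => -[/andP[h1 h2]|[Ut /andP[h1 h2]]].
      split; first by apply: step => /=; rewrite in_itv /= h1 ltW.
      by rewrite h2 andbT; lra.
    by split => //; rewrite h1; lra.
  rewrite measureU //; last 2 first.
  + exact: mUx.
  + rewrite -subset0 => t /=; rewrite !in_itv /= => -[/andP[h1 _] [_ /andP[_ h2]]].
    lra.
  have mxy : mu (`[x, y[%classic) = (y - x)%:E.
    rewrite lebesgue_measure_itv /= lte_fin; have [//|yx] := ltP x y.
    by rewrite (_ : y = x) ?subrr //; lra.
  by apply: leeD => //; rewrite -mxy.
- rewrite big_cons /=.
  have := ler_norm (f x - f y); rewrite distrC => h.
  have : e1 * (x - a) <= e1 * (y - a) by rewrite ler_wpM2l // lerD2r.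
  by lra.
Qed.

(** An absolutely continuous function whose derivative is nonnegative almost
    everywhere is nondecreasing. A null set containing the bad points is
    enclosed in an open set [U] of small measure; by real induction, [a] is
    linked to [b] by finitely many steps, each of which either lies in [U] or
    is one along which [f] decreases at slope at most [e1]. Absolute continuity
    bounds the contribution of the steps lying in [U]. *)
Lemma ac_nondecreasing a b f : a <= b -> abs_continuous_segment a b f ->
  {ae mu, forall t, a <= t <= b -> exists2 d, is_derive t (1 : R) f d & 0 <= d} ->
  f a <= f b.
Proof.
move=> ab acf [N [mN N0 bad]].
apply/ler_addgt0Pr => e e0.
(* The slope contributes at most e1 * (b - a) and the steps in U at most e1. *)
pose e1 := e / (b - a + 1).
have ba1 : 0 < b - a + 1 by lra.
have e10 : 0 < e1 by rewrite divr_gt0.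
have [d d0 H] := acf _ e10.
have [U [oU NU muU]] : exists U : set R,
    [/\ open U, N `<=` U & (mu U < d%:E)%E].
  have [|U [oU NU muU]] := lebesgue_regularity_outer mN _ d0.
    by rewrite [X in (X < _)%E](_ : _ = 0%E) // ltry.
  exists U; split => //.
  have mU : measurable U by exact: open_measurable.
  have dis : (U `\` N) `&` N = set0 by apply/seteqP; split => // t -[[_ ?]].
  have mUN : measurable (U `\` N) by exact: measurableD.
  have -> : U = (U `\` N) `|` N by rewrite setUC setDUK.
  rewrite measureU //.
  by rewrite [X in (_ + X)%E](_ : _ = 0%E) ?adde0.
have mU : measurable U by exact: open_measurable.
have stepP c : a <= c <= b -> exists2 h, 0 < h & forall x y, x <= y ->
   c - h < x -> y < c + h -> x = c \/ y = c ->
   `[x, y] `<=` U \/ f x <= f y + e1 * (y - x).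
  move=> cab; have [cN|cN] := pselect (N c).
    have := open_nbhs_nbhs (conj oU (NU _ cN)); rewrite -nbhs_ballE => -[h /= h0 hU].
    exists h => // x y xy cx yc _; left => t; rewrite /= in_itv /= => /andP[xt ty].
    by apply: hU; rewrite /ball /= ltr_norml; apply/andP; split; lra.
  have [D [dD fD] D0] : exists2 d, is_derive c (1 : R) f d & 0 <= d.
    apply: contrapT => nd; apply: cN; apply: bad => /= h; apply: nd.
    exact: h.
  move/derivable1P: (dD) => _.
  have := dD; rewrite /derivable => /cvg_ex [l cl].
  have lD : l = D by rewrite -fD; apply/esym/cvg_lim.
  move: cl; rewrite lD => /cvgrPdist_lt /(_ _ e10).
  rewrite /dnbhs near_withinE -nbhs_ballE => -[h /= h0 hP].
  exists h => // x y xy cx yc xyc; right.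
  have [->|xNy] := eqVneq x y; first by rewrite subrr mulr0 addr0.
  have xy' : x < y by rewrite lt_neqAle xNy.
  have key k : `|k| < h -> k != 0 -> - e1 < k^-1 * (f (k + c) - f c).
    move=> kh k0; have := hP k; rewrite /ball /= sub0r normrN => /(_ kh k0).
    rewrite /GRing.scale /= mulr1 ltr_norml => /andP[_]; lra.
  case: xyc => xyc; subst.
  + have := key (y - c); rewrite subrK => /(_ _ _).
    rewrite ltr_norml => /(_ _ _) K.
    have := K; rewrite subr_eq0 eq_sym xNy.
    have -> : - h < y - c < h by apply/andP; split; lra.
    move=> /(_ isT isT); rewrite -ltr_pdivrMl ?invr_gt0 ?subr_gt0 // invrK; lra.
  + have := key (x - c); rewrite subrK.
    have -> : `|x - c| < h by rewrite ltr_norml; apply/andP; split; lra.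
    rewrite subr_eq0 xNy => /(_ isT isT).
    rewrite -[(_ - _)^-1 * _]mulrNN -invrN opprB.
    rewrite -ltr_pdivrMl ?invr_gt0 ?subr_gt0 // invrK; lra.
pose S := [set x | a <= x <= b /\ reach U e1 f a x].
have reacha : reach U e1 f a a.
  exists [::]; split => //; first by rewrite big_nil measure_ge0.
  by rewrite big_nil subrr mulr0 !addr0.
have Sa : S a by rewrite /S /= lexx ab.
have ubS : ubound S b by move=> x [/andP[]].
have hsS : has_sup S by split; [exists a | exists b].
pose c := sup S.
have ac : a <= c by apply: sup_upper_bound.
have cb : c <= b by apply: sup_le_ub => //; exists a.
have [h h0 st] := stepP c ltac:(by rewrite ac cb).
have reachc : reach U e1 f a c.
  have [x [/andP[ax xb] rx] cx] := sup_adherent h0 hsS.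
  have xc : x <= c by apply: sup_upper_bound => //; split => //; rewrite ax.
  by apply: (reach_step (ltW e10) mU ax xc _ rx); apply: st => //; [lra|right].
have reachb : reach U e1 f a b.
  have [->//|cNb] := eqVneq b c.
  have cb' : c < b by rewrite lt_neqAle eq_sym cNb.
  pose y := Num.min b (c + h / 2).
  have cy : c < y by rewrite lt_min cb' ltrDl divr_gt0.
  have : y <= c.
    apply: sup_upper_bound => //; split.
      by rewrite (le_trans ac (ltW cy)) ge_min lexx.
    apply: (reach_step (ltW e10) mU ac (ltW cy) _ reachc); apply: st => //.
    - exact: ltW.
    - by lra.
    - by rewrite gt_min; apply/orP; right; lra.
    - by left.
  by rewrite leNgt cy.
have [L [L1 L2 L3 L4]] := reachb.
have sumd : \sum_(p <- L) (p.2 - p.1) < d.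
  rewrite -lte_fin; apply: le_lt_trans L3 (le_lt_trans _ muU).
  by rewrite le_measure ?inE //; exact: measurableI.
have := H (size L) (fun k => (nth (0, 0) L k).1) (fun k => (nth (0, 0) L k).2).
rewrite -(big_mkord xpredT (fun k => (nth (0, 0) L k).2 - (nth (0, 0) L k).1)).
rewrite -(big_mkord xpredT
  (fun k => `|f (nth (0, 0) L k).2 - f (nth (0, 0) L k).1|)).
rewrite -(big_nth (0, 0) xpredT (fun p : R * R => p.2 - p.1)).
rewrite -(big_nth (0, 0) xpredT (fun p : R * R => `|f p.2 - f p.1|)).
have sz : \sum_(p <- L) `|f p.2 - f p.1| < e1 -> f a <= f b + e.
  move=> h1; have : e1 * (b - a + 1) = e by rewrite /e1 divfK // gt_eqF.
  lra.
move=> HH; apply: sz; apply: HH => //.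
  by move=> k; have [] := L1 _ (mem_nth (0, 0) (ltn_ord k)).
move=> j k jk; move/(pairwiseP (0, 0)): L2 => L2.
have [jk'|kj|/val_inj jk'] := ltngtP j k; last by rewrite jk' eqxx in jk.
- by right; apply: L2; rewrite ?inE.
- by left; apply: L2; rewrite ?inE.
Qed.

End AbsoluteContinuity.

(** * Indefinite Lebesgue integrals *)

Section Primitive.
Context {R : realType}.
Implicit Types (a b : R) (g : R -> R).
Notation mu := (@lebesgue_measure R).

Lemma ae_neq (c : R) : {ae mu, forall t, t != c}.
Proof.
exists [set c]; split => //; first exact: lebesgue_measure_set1.
by move=> t /= /negP; rewrite negbK => /eqP.
Qed.

Lemma bigsetU_itv_measure N (s t : 'I_N -> R) :
  (forall k, s k <= t k) ->
  (forall j k, j != k -> t j <= s k \/ t k <= s j) ->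
  trivIset setT (fun k => `]s k, t k]%classic) /\
  mu (\big[setU/set0]_(k < N) `]s k, t k]%classic) = (\sum_(k < N) (t k - s k))%:E.
Proof.
move=> st dis.
have tr : trivIset setT (fun k => `]s k, t k]%classic).
  apply/trivIsetP => j k _ _ jk; rewrite -subset0 => x /=.
  rewrite !in_itv /= => -[/andP[h1 h2] /andP[h3 h4]].
  by case: (dis _ _ jk) => ?; lra.
split => //; rewrite measure_bigsetU_ord // -sumEFin.
apply: eq_bigr => k _; rewrite [LHS]lebesgue_measure_itv /= lte_fin.
have [//|h] := ltP (s k) (t k).
by rewrite (_ : s k = t k) ?subrr //; apply/eqP; rewrite eq_le st h.
Qed.

(** The indefinite Lebesgue integral of an integrable function is absolutely
    continuous, and by Lebesgue's theorem the function is its derivative almost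
    everywhere. *)
Lemma primitive_ac b g : mu.-integrable `[0, b] (EFin \o g) ->
  let F := fun t => \int[mu]_(s in `[0, t]) (g \_ `[0, b]) s in
  abs_continuous_segment 0 b F /\
  {ae mu, forall t, 0 <= t <= b -> is_derive t (1 : R) F (g t)}.
Proof.
move=> intg F.
have intG : mu.-integrable setT (EFin \o (g \_ `[0, b])).
  by rewrite -restrict_EFin; apply/integrable_restrict => //; rewrite setTI.
have intGs (A : set R) : measurable A -> mu.-integrable A (EFin \o (g \_ `[0, b])).
  by move=> mA; apply: integrableS intG.
split.
  move=> e e0; have [d [d0 H]] := integral_normr_continuous intG e0.
  exists d => // N s t st dis sd.
  have st' k : s k <= t k by have [_ []] := st k.
  have [tr muU] := bigsetU_itv_measure st' dis.
  set U := \big[setU/set0]_(k < N) _ in muU.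
  have mU : measurable U by apply: bigsetU_measurable => k _.
  have muUd : (mu U < d%:E)%E by rewrite muU lte_fin.
  have := H _ mU muUd; apply: le_lt_trans.
  have step k : `|F (t k) - F (s k)| <=
      \int[mu]_(x in `]s k, t k]) `|(g \_ `[0, b]) x|.
    rewrite /F Rintegral_itvB //; first last.
    - by rewrite bnd_simp; have [] := st k.
    - by rewrite bnd_simp; have [] := st k.
    - exact: intGs.
    by apply: le_normr_Rintegral => //; exact: intGs.
  apply: (le_trans (ler_sum _ (fun k _ => step k))).
  rewrite -lee_fin -sumEFin /Rintegral.
  have fin (A : set R) : measurable A ->
      ((\int[mu]_(x in A) (`|(g \_ `[0, b]) x|)%:E) \is a fin_num)%E.
    move=> mA; apply: integrable_fin_num => //.
    by have := integrable_norm (intGs _ mA).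
  rewrite fineK; last exact: fin.
  rewrite ge0_integral_bigsetU //=.
  - by apply: lee_sum => k _; rewrite fineK //; exact: fin.
  - by rewrite /index_enum -enumT enum_uniq.
  - by apply: sub_trivIset tr.
  - apply: measurable_funTS; apply/measurable_EFinP; apply: measurableT_comp => //.
    by apply/measurable_EFinP; case/integrableP: intG.
have aeDeriv := @FTC1 R (g \_ `[0, b]) (BLeft 0) (fun y => intGs _ (measurable_itv _))
  (integrable_locally_restrict (measurable_itv _) intg).
have := aeDeriv; have := ae_neq 0.
apply: filterS2; first exact: (ae_filter_ringOfSetsType mu).
move=> t t_neq0 Ht /andP[t0 tb].
have [|D1 D2] := Ht; first by rewrite (@lte_fin R) lt_def t_neq0.
apply: DeriveDef => //; rewrite -derive1E D2 patchE mem_set //=.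
by rewrite in_itv /= t0.
Qed.

End Primitive.

(** * Quadratic forms *)

Section QuadraticForms.
Context {R : realType}.

(** Euclidean inner product of column vectors. *)
Definition dotv d (v w : 'cV[R]_d) : R := (v^T *m w) 0 0.

(** Squared Euclidean norm. *)
Definition sqn d (v : 'cV[R]_d) : R := dotv v v.

Lemma dotvE d (v w : 'cV[R]_d) : dotv v w = \sum_i v i 0 * w i 0.
Proof. by rewrite /dotv mxE; apply: eq_bigr => i _; rewrite mxE. Qed.

Lemma dotvC d (v w : 'cV[R]_d) : dotv v w = dotv w v.
Proof. by rewrite !dotvE; apply: eq_bigr => i _; rewrite mulrC. Qed.

Lemma dotvDr d (u v w : 'cV[R]_d) : dotv u (v + w) = dotv u v + dotv u w.
Proof. by rewrite /dotv mulmxDr mxE. Qed.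

Lemma dotvDl d (u v w : 'cV[R]_d) : dotv (v + w) u = dotv v u + dotv w u.
Proof. by rewrite dotvC dotvDr !(dotvC u). Qed.

Lemma dotvZr d (a : R) (u v : 'cV[R]_d) : dotv u (a *: v) = a * dotv u v.
Proof. by rewrite /dotv -scalemxAr mxE. Qed.

Lemma dotvZl d (a : R) (u v : 'cV[R]_d) : dotv (a *: u) v = a * dotv u v.
Proof. by rewrite dotvC dotvZr dotvC. Qed.

Lemma dotv_mulmx d e (M : 'M[R]_(d, e)) (u : 'cV[R]_d) (v : 'cV[R]_e) :
  dotv u (M *m v) = dotv (M^T *m u) v.
Proof. by rewrite /dotv trmx_mul trmxK mulmxA. Qed.

Lemma quad_dotv d (M : 'M[R]_d) (v : 'cV[R]_d) : quad M v = dotv v (M *m v).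
Proof. by rewrite /quad /dotv mulmxA. Qed.

Lemma sqn_sum d (v : 'cV[R]_d) : sqn v = \sum_i v i 0 ^+ 2.
Proof. by rewrite /sqn dotvE; apply: eq_bigr => i _; rewrite expr2. Qed.

Lemma sqn_ge0 d (v : 'cV[R]_d) : 0 <= sqn v.
Proof. by rewrite sqn_sum sumr_ge0 // => i _; exact: sqr_ge0. Qed.

Lemma sqr_le_sqn d (v : 'cV[R]_d) i : v i 0 ^+ 2 <= sqn v.
Proof.
by rewrite sqn_sum (bigD1 i) //= lerDl sumr_ge0 // => j _; exact: sqr_ge0.
Qed.

Lemma sqn_eq0 d (v : 'cV[R]_d) : sqn v <= 0 -> v = 0.
Proof.
move=> v0; apply/colP => i; rewrite mxE; apply/eqP; rewrite -sqrf_eq0.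
by rewrite eq_le sqr_ge0 andbT (le_trans (sqr_le_sqn v i)).
Qed.

Lemma sqn_gt0 d (v : 'cV[R]_d) : v != 0 -> 0 < sqn v.
Proof. by move=> v0; rewrite ltNge; apply: contra v0 => /sqn_eq0 ->. Qed.

Lemma sqn_mulmx d e (M : 'M[R]_(d, e)) (v : 'cV[R]_e) :
  sqn (M *m v) = quad (M^T *m M) v.
Proof. by rewrite /sqn quad_dotv dotv_mulmx dotvC mulmxA. Qed.

Lemma sqn_col_mx d e (v : 'cV[R]_d) (w : 'cV[R]_e) :
  sqn (col_mx v w) = sqn v + sqn w.
Proof. by rewrite /sqn /dotv tr_col_mx mul_row_col mxE. Qed.

Lemma quad_bound d (M : 'M[R]_d) :
  exists2 a, 0 < a & forall v, `|quad M v| <= a * sqn v.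
Proof.
exists (1 + \sum_i \sum_j `|M i j|).
  rewrite ltr_pwDl // sumr_ge0 // => i _; exact: sumr_ge0.
move=> v; rewrite quad_dotv dotvE.
apply: (@le_trans _ _ ((\sum_i \sum_j `|M i j|) * sqn v)); last first.
  by rewrite ler_wpM2r ?sqn_ge0 // lerDr.
rewrite mulr_suml; apply: le_trans (ler_norm_sum _ _ _) _.
apply: ler_sum => i _; rewrite mxE mulr_suml mulr_sumr.
apply: le_trans (ler_norm_sum _ _ _) _.
apply: ler_sum => j _; rewrite mulrCA normrM ler_wpM2l //.
have := sqr_le_sqn v i; have := sqr_le_sqn v j.
move: (v i 0) (v j 0) (sqn v) => a b s ha hb.
by rewrite ler_norml; apply/andP; split; nra.
Qed.

Lemma sqn_mulmx_bound d e (M : 'M[R]_(d, e)) :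
  exists2 a, 0 < a & forall v, sqn (M *m v) <= a * sqn v.
Proof.
have [a a0 H] := quad_bound (M^T *m M); exists a => // v.
by rewrite sqn_mulmx (le_trans (ler_norm _)).
Qed.

Lemma psd_cauchy_schwarz d (S : 'M[R]_d) (v w : 'cV[R]_d) :
  S^T = S -> possemidefmx S -> 0 < quad S w ->
  dotv v (S *m w) ^+ 2 <= quad S v * quad S w.
Proof.
move=> ST Spos w0.
have wv : dotv w (S *m v) = dotv v (S *m w) by rewrite dotv_mulmx ST dotvC.
pose a := - (dotv v (S *m w) / quad S w).
have := Spos (v + a *: w).
rewrite quad_dotv mulmxDr -scalemxAr !(dotvDl, dotvDr, dotvZl, dotvZr) wv.
rewrite -!quad_dotv /a.
set b := dotv _ _; set p := quad S v; set q := quad S w in w0 *.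
have qn0 : q != 0 by rewrite gt_eqF.
have -> : p + - (b / q) * b + (- (b / q) * b + - (b / q) * (- (b / q) * q)) =
  (p * q - b ^+ 2) / q by field.
by rewrite pmulr_lge0 ?invr_gt0 // subr_ge0.
Qed.

Lemma posdef_semidef d (S : 'M[R]_d) : posdefmx S -> possemidefmx S.
Proof.
move=> Spos v; have [->|v0] := eqVneq v 0; last exact/ltW/Spos.
by rewrite /quad mulmx0 mxE.
Qed.

Lemma posdef_unitmx d (S : 'M[R]_d) : posdefmx S -> S \in unitmx.
Proof.
move=> Spos; rewrite -row_free_unit -kermx_eq0; apply/eqP/row_matrixP => i.
rewrite row0; set v := row i _.
have vS : v *m S = 0 by rewrite -row_mul mulmx_ker row0.
apply/eqP; apply: contraT => v0.
have := Spos v^T; rewrite trmx_eq0 => /(_ v0).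
by rewrite /quad trmxK vS mul0mx mxE ltxx.
Qed.

(** A symmetric positive definite form dominates a multiple of the Euclidean
    one: by the Cauchy-Schwarz inequality for [S] applied to [v] and
    [S^-1 v], the square of [v^T v] is at most [v^T S v * v^T S^-1 v]. *)
Lemma posdef_coercive d (S : 'M[R]_d) : S^T = S -> posdefmx S ->
  exists2 al, 0 < al & forall v, al * sqn v <= quad S v.
Proof.
move=> ST Spos; have Su := posdef_unitmx Spos.
have [a a0 H] := quad_bound (invmx S).
exists a^-1; first by rewrite invr_gt0.
move=> v; have [->|v0] := eqVneq v 0.
  by rewrite /sqn dotvE big1 ?mulr0 ?posdef_semidef // => i _; rewrite mxE mul0r.
have s0 := sqn_gt0 v0.
pose w := invmx S *m v.
have Sw : S *m w = v by rewrite /w mulmxA mulmxV // mul1mx.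
have w0 : w != 0.
  by apply: contra_neq v0 => w0; rewrite -Sw w0 mulmx0.
have := psd_cauchy_schwarz v ST (posdef_semidef Spos) (Spos _ w0).
rewrite Sw (quad_dotv S w) Sw dotvC -quad_dotv -/(sqn v) => CS.
have le : sqn v ^+ 2 <= quad S v * (a * sqn v).
  apply: le_trans CS _; rewrite ler_wpM2l ?posdef_semidef //.
  exact: le_trans (ler_norm _) (H v).
rewrite mulrC ler_pdivrMr // -(ler_pM2r s0).
by rewrite -expr2 -mulrA.
Qed.

(** Along a curve the derivative of a symmetric quadratic form is twice its
    polar form. *)
Lemma is_derive_quad d (M : 'M[R]_d) (p : R -> 'cV[R]_d) (f : 'cV[R]_d) (t : R) :
  M^T = M -> (forall i, is_derive t (1 : R) (fun s => p s i 0) (f i 0)) ->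
  is_derive t (1 : R) (fun s => quad M (p s)) (2 * dotv (p t) (M *m f)).
Proof.
move=> MT dp.
have -> : (fun s => quad M (p s)) =
    \sum_(i < d) \sum_(j < d) (fun s => M i j * (p s i 0 * p s j 0)).
  apply/funext => s; rewrite quad_dotv dotvE fct_sumE; apply: eq_bigr => i _.
  rewrite fct_sumE mxE mulr_sumr; apply: eq_bigr => j _.
  by rewrite mulrCA.
have D i j : is_derive t (1 : R) (fun s => M i j * (p s i 0 * p s j 0))
    (M i j * (p t i 0 * f j 0 + p t j 0 * f i 0)).
  have := is_deriveZ (M i j) (is_deriveM (dp i) (dp j)).
  exact.
have D2 i : is_derive t (1 : R)
    (\sum_(j < d) (fun s => M i j * (p s i 0 * p s j 0)))
    (\sum_(j < d) M i j * (p t i 0 * f j 0 + p t j 0 * f i 0)).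
  exact: is_derive_sum.
have := is_derive_sum D2.
suff -> : \sum_(i < d) \sum_(j < d)
    M i j * (p t i 0 * f j 0 + p t j 0 * f i 0) = 2 * dotv (p t) (M *m f).
  exact.
have -> : 2 * dotv (p t) (M *m f) = dotv (p t) (M *m f) + dotv f (M *m p t).
  by rewrite [X in _ + X]dotv_mulmx MT dotvC mulr2n mulrDl mul1r.
rewrite !dotvE [X in _ = _ + X](_ : _ =
   \sum_i \sum_j M i j * (p t j 0 * f i 0)); last first.
  by apply: eq_bigr => i _; rewrite mxE mulr_sumr; apply: eq_bigr => j _; ring.
rewrite -big_split /=; apply: eq_bigr => i _.
rewrite mxE mulr_sumr -big_split /=; apply: eq_bigr => j _; ring.
Qed.

Lemma quad_ac d (M : 'M[R]_d) (p : R -> 'cV[R]_d) a b :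
  (forall i, abs_continuous_segment a b (fun t => p t i 0)) ->
  abs_continuous_segment a b (fun t => quad M (p t)).
Proof.
move=> acp.
have -> : (fun s => quad M (p s)) =
    (fun s => \sum_(i < d) \sum_(j < d) M i j * (p s i 0 * p s j 0)).
  apply/funext => s; rewrite quad_dotv dotvE; apply: eq_bigr => i _.
  by rewrite mxE mulr_sumr; apply: eq_bigr => j _; rewrite mulrCA.
by apply: ac_sum => i; apply: ac_sum => j; apply: acZ; apply: acM.
Qed.

End QuadraticForms.

(** * Vector-valued functions and their derivatives *)

Section LinearODE.
Context {R : realType}.
Notation mu := (@lebesgue_measure R).

Lemma AC_sub (I J : set R) q (p : R -> 'cV[R]_q) : J `<=` I -> AC I p -> AC J p.
Proof. by move=> JI acp i a b abJ; apply: acp; exact: subset_trans JI. Qed.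

Lemma AC_itvP a b q (p : R -> 'cV[R]_q) :
  AC `[a, b] p <-> forall i, abs_continuous_segment a b (fun t => p t i 0).
Proof.
split=> [acp i|acp i a' b' sub]; first by apply: acp.
have [ab|ba] := leP a' b'; last first.
  move=> e e0; exists 1 => // N s t st _ _.
  rewrite big1 // => k _; have [h1 [h2 h3]] := st k; exfalso; lra.
have /sub : `[a', b']%classic a' by rewrite /= in_itv /= lexx.
have /sub : `[a', b']%classic b' by rewrite /= in_itv /= lexx ab.
rewrite /= !in_itv /= => /andP[_ h1] /andP[h2 _].
by apply: ac_subsegment (acp i).
Qed.

Lemma has_derivative_ae_sub (I J : set R) q (p f : R -> 'cV[R]_q) : J `<=` I ->
  has_derivative_ae I p f -> has_derivative_ae J p f.
Proof.
move=> JI; apply: filterS; first exact: (ae_filter_ringOfSetsType mu).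
by move=> t H /JI; exact: H.
Qed.

Lemma subset_itv_cc0y (b : R) : `[0, b] `<=` `[0, +oo[.
Proof. by move=> t /=; rewrite !in_itv /= andbT => /andP[]. Qed.

Lemma is_derive_mulmx q e (M : 'M[R]_(e, q)) (p : R -> 'cV[R]_q) (f : 'cV[R]_q)
    (t : R) : (forall i, is_derive t (1 : R) (fun s => p s i 0) (f i 0)) ->
  forall i, is_derive t (1 : R) (fun s => (M *m p s) i 0) ((M *m f) i 0).
Proof.
move=> dp i.
have -> : (fun s => (M *m p s) i 0) = \sum_(j < q) (fun s => M i j * p s j 0).
  by apply/funext => s; rewrite mxE fct_sumE.
by rewrite mxE; apply: is_derive_sum.
Qed.

Lemma mulmx_ac q e (M : 'M[R]_(e, q)) (p : R -> 'cV[R]_q) a b :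
  (forall i, abs_continuous_segment a b (fun t => p t i 0)) ->
  forall i, abs_continuous_segment a b (fun t => (M *m p t) i 0).
Proof.
move=> acp i; under eq_fun do rewrite mxE.
by apply: (ac_sum (F := fun j t => M i j * p t j 0)) => j; exact: acZ.
Qed.

Lemma AC_mulmx (I : set R) q e (M : 'M[R]_(e, q)) (p : R -> 'cV[R]_q) :
  AC I p -> AC I (fun t => M *m p t).
Proof. by move=> acp i a b abI; apply: mulmx_ac => j; exact: acp. Qed.

Lemma is_derive_continuous (f : R -> R) (t d : R) :
  is_derive t (1 : R) f d -> {for t, continuous f}.
Proof. by move=> [df _]; apply/differentiable_continuous/derivable1_diffP. Qed.

Lemma C1_ac a b (f g : R -> R) :
  (forall t : R, a <= t <= b -> is_derive t (1 : R) f (g t)) -> continuous g ->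
  abs_continuous_segment a b f.
Proof.
move=> df cg; have [ab|ba] := leP a b; last first.
  move=> e e0; exists 1 => // N s t st _ _.
  rewrite big1 // => k _; have [h1 [h2 h3]] := st k; exfalso; lra.
have cn : {within `[a, b], continuous (fun x => `|g x|)}.
  apply: continuous_subspaceT => x; apply: continuous_comp; first exact: cg.
  exact: norm_continuous.
have [c _ H] := EVT_max ab cn.
apply: (@ac_lipschitz _ _ _ _ `|g c|) => x y ax xy yb.
have cf : {within `[x, y], continuous f}.
  apply: derivable_within_continuous => s; rewrite in_itv /= => /andP[xs sy].
  by have [] := df s _; last done; apply/andP; split; lra.
have dfi s : s \in `]x, y[ -> is_derive s (1 : R) f (g s).
  by rewrite in_itv /= => /andP[xs sy]; apply: df; apply/andP; split; lra.
have [s] := MVT_segment xy dfi cf.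
rewrite in_itv /= => /andP[xs sy] ->.
rewrite normrM (ger0_norm (_ : 0 <= y - x)) ?subr_ge0 //.
rewrite ler_wpM2r ?subr_ge0 // H // in_itv /=; apply/andP; split; lra.
Qed.

(** * Existence for linear systems *)

Lemma cvg_sum_fin (T : Type) (F : set_system T) {FF : Filter F} d
    (u : 'I_d -> T -> R) (l : 'I_d -> R) :
  (forall i, u i @ F --> l i) ->
  (fun n => \sum_i u i n) @ F --> \sum_i l i.
Proof.
elim: d u l => [|d IH] u l ul.
  under eq_fun do rewrite big_ord0; rewrite big_ord0; exact: cvg_cst.
under eq_fun do rewrite big_ord_recl; rewrite big_ord_recl.
by apply: cvgD; [exact: ul|exact: IH].
Qed.

(** Coefficients of the power series of the [i]-th component of
    [exp (t F) v0]. *)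
Definition ode_coef d (F : 'M[R]_d) (v0 : 'cV[R]_d) (i : 'I_d) : R^nat :=
  fun k => (iter k (mulmx F) v0) i 0 / k`!%:R.

Lemma ode_coefS d (F : 'M[R]_d) (v0 : 'cV[R]_d) i :
  pseries_diffs (ode_coef F v0 i) = ode_coef F (F *m v0) i.
Proof.
apply/funext => k; rewrite /pseries_diffs /ode_coef -iterSr factS natrM.
by rewrite invfM mulrCA mulVKf ?pnatr_eq0.
Qed.

Lemma ode_coef_cvg d (F : 'M[R]_d) (v0 : 'cV[R]_d) i (x : R) :
  cvgn (pseries (ode_coef F v0 i) x).
Proof.
pose M := \sum_i \sum_j `|F i j|; pose B := \sum_i `|v0 i 0|.
have M0 : 0 <= M by apply: sumr_ge0 => j _; exact: sumr_ge0.
have B0 : 0 <= B by exact: sumr_ge0.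
have bnd k : \sum_j `|(iter k (mulmx F) v0) j 0| <= M ^+ k * B.
  elim: k => [|k IH]; first by rewrite expr0 mul1r.
  rewrite iterS exprS -mulrA; apply: le_trans (ler_wpM2l M0 IH).
  rewrite /M mulr_suml; apply: ler_sum => j _.
  rewrite mxE (le_trans (ler_norm_sum _ _ _)) // mulr_suml.
  apply: ler_sum => h _; rewrite normrM ler_wpM2l //.
  by rewrite (bigD1 h) //= lerDl sumr_ge0.
apply: normed_cvg; apply: (@series_le_cvg _ _ (B *: exp_coeff (M * `|x|))).
- by move=> n /=.
- move=> n; rewrite /exp_coeff /= mulr_ge0 // divr_ge0 ?exprn_ge0 ?mulr_ge0 //.
- move=> n.
  have -> : (B *: exp_coeff (M * `|x|)) n = (M ^+ n * B) / n`!%:R * `|x| ^+ n.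
    have -> : (B *: exp_coeff (M * `|x|)) n = B * ((M * `|x|) ^+ n / n`!%:R) by [].
    by rewrite exprMn; ring.
  rewrite /ode_coef /= normrM normrM normrX normfV normr_nat.
  rewrite ler_wpM2r ?exprn_ge0 // ler_wpM2r ?invr_ge0 //.
  by rewrite (le_trans _ (bnd n)) // (bigD1 i) //= lerDl sumr_ge0.
- by apply: is_cvg_seriesZ; exact: is_cvg_series_exp_coeff.
Qed.

(** The matrix exponential: a linear autonomous system has a smooth solution on
    the whole line, given by its power series. *)
Lemma linear_ode_exists d (F : 'M[R]_d) (v0 : 'cV[R]_d) :
  exists2 v : R -> 'cV[R]_d, v 0 = v0 &
    forall t i, is_derive t (1 : R) (fun s => v s i 0) ((F *m v t) i 0).
Proof.
pose v t : 'cV[R]_d := \col_i limn (pseries (ode_coef F v0 i) t).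
exists v.
  apply/colP => i; rewrite mxE; apply: cvg_lim => //.
  rewrite -(cvg_shiftS _); apply: cvg_near_cst; near=> n.
  rewrite /pseries /series /= big_nat_recl // big1 ?addr0.
    by rewrite expr0 mulr1 /ode_coef /= divr1.
  by move=> k _; rewrite expr0n mulr0.
move=> t i.
have -> : (fun s => v s i 0) = (fun s => limn (pseries (ode_coef F v0 i) s)).
  by apply/funext => s; rewrite mxE.
have -> : (F *m v t) i 0 = limn (pseries (pseries_diffs (ode_coef F v0 i)) t).
  apply/esym/cvg_lim => //; rewrite ode_coefS mxE.
  have -> : pseries (ode_coef F (F *m v0) i) t =
      (fun n => \sum_j F i j * pseries (ode_coef F v0 j) t n).
    apply/funext => n; rewrite /pseries /series /=.
    under [RHS]eq_bigr do rewrite mulr_sumr.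
    rewrite exchange_big /=; apply: eq_bigr => k _.
    rewrite /ode_coef -iterSr iterS mxE !mulr_suml.
    by apply: eq_bigr => j _; rewrite !mulrA.
  apply: (@cvg_sum_fin _ _ _ d
    (fun j n => F i j * pseries (ode_coef F v0 j) t n)) => j.
  rewrite mxE; apply: cvgMr.
  exact: ode_coef_cvg.
apply: (@pseries_snd_diffs _ _ (`|t| + 1)); rewrite ?ode_coefS;
  try exact: ode_coef_cvg.
by rewrite [ltRHS]ger0_norm ?addr_ge0 // ltrDl.
Unshelve. all: by end_near. Qed.

(** * Uniqueness for linear systems *)

Lemma linear_ode_AC d (F : 'M[R]_d) (v : R -> 'cV[R]_d) (I : set R) :
  (forall t i, is_derive t (1 : R) (fun s => v s i 0) ((F *m v t) i 0)) ->
  AC I v /\ has_derivative_ae I v (fun t => F *m v t).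
Proof.
move=> dv; split; last by apply: aeW => t _ i; exact: dv.
move=> i a b _; apply: (@C1_ac _ _ _ (fun t => (F *m v t) i 0)) => // t.
exact: is_derive_continuous (is_derive_mulmx F (dv t) i).
Qed.

(** If [c |v|^2] bounds [v^T F v], then [exp (- 2 c t) |p|^2] is
    nonincreasing. *)
Lemma linear_ode_zero d (F : 'M[R]_d) (p : R -> 'cV[R]_d) (b : R) :
  AC `[0, b] p -> has_derivative_ae `[0, b] p (fun t => F *m p t) ->
  p 0 = 0 -> forall t, 0 <= t <= b -> p t = 0.
Proof.
move=> /AC_itvP acp dp p0 t /andP[t0 tb]; apply: sqn_eq0.
have [c c0 Hc] := quad_bound F.
pose h s := expR (- (2 * c) * s).
have dh s : is_derive s (1 : R) h (- (2 * c) * h s).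
  have D1 : is_derive s (1 : R) (fun s : R => - (2 * c) * s) (- (2 * c)).
    have := is_deriveZ (- (2 * c)) (is_derive_id s (1 : R)).
    by rewrite [_ *: 1]mulr1.
  have := is_derive1_comp (is_derive_expR _) D1.
  by rewrite [X in is_derive _ _ _ X -> _]mulrC.
have ch : continuous h by move=> s; exact: is_derive_continuous (dh s).
have ach : abs_continuous_segment 0 t h.
  apply: (@C1_ac _ _ _ (fun s => - (2 * c) * h s)) => // s.
  by apply: cvgMr; exact: ch.
have acq : abs_continuous_segment 0 t (fun s => quad 1%:M (p s)).
  by apply: quad_ac => i; apply: ac_subsegment (acp i).
have acF : abs_continuous_segment 0 t (fun s => - 1 * (h s * quad 1%:M (p s))).
  by apply: acZ; apply: acM.
have := ac_nondecreasing t0 acF.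
rewrite p0 /quad mulmx0 mxE !mulr0 mulN1r oppr_ge0 mulmx1 => H.
have : h t * sqn (p t) <= 0.
  apply: H; move: dp; apply: filterS; first exact: (ae_filter_ringOfSetsType mu).
  move=> s ds /andP[s0 st].
  have {}ds := ds _; have /ds {}ds : `[0, b]%classic s.
    by rewrite /= in_itv /= s0 (le_trans st).
  have dq := is_derive_quad (trmx1 _ _) ds.
  have dE := is_deriveZ (- 1) (is_deriveM (dh s) dq).
  eexists; first exact: dE.
  rewrite /GRing.scale /= mul1mx quad_dotv mul1mx -quad_dotv -/(sqn _).
  have := Hc (p s); rewrite ler_norml => /andP[_ Hs].
  have hs : 0 < h s by exact: expR_gt0.
  have : 0 <= h s * (c * sqn (p s) - quad F (p s)) by rewrite mulr_ge0 ?subr_ge0 // ltW.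
  by nra.
by rewrite pmulr_rle0 // expR_gt0.
Qed.

Lemma linear_ode_unique d (F : 'M[R]_d) (p q : R -> 'cV[R]_d) (b : R) :
  AC `[0, b] p -> has_derivative_ae `[0, b] p (fun t => F *m p t) ->
  AC `[0, b] q -> has_derivative_ae `[0, b] q (fun t => F *m q t) ->
  p 0 = q 0 -> forall t, 0 <= t <= b -> p t = q t.
Proof.
move=> /AC_itvP acp dp /AC_itvP acq dq pq t tb; apply/subr0_eq.
apply: (linear_ode_zero (F := F) (p := fun t => p t - q t)) tb; rewrite ?pq ?subrr //.
  apply/AC_itvP => i; under eq_fun do rewrite !mxE -mulN1r.
  exact: (acD (acp i) (acZ _ (acq i))).
move: dp dq; apply: filterS2; first exact: (ae_filter_ringOfSetsType mu).
move=> s dp dq sI i; under eq_fun do rewrite !mxE.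
rewrite mulmxBr mxE [X in _ + X]mxE.
by apply: is_deriveB; [exact: dp|exact: dq].
Qed.

(** * Square-integrable solutions vanish at infinity *)

(** The function [W] is any bounded quantity whose derivative dominates [|p|^2].
    It bounds both the increments of [|p|^2] and the time during which [|p|^2] is
    not small. *)
Lemma linear_ode_L2_tends_to_zero d (F : 'M[R]_d) (p : R -> 'cV[R]_d)
    (W : R -> R) (C : R) :
  AC `[0, +oo[ p -> has_derivative_ae `[0, +oo[ p (fun t => F *m p t) ->
  (forall b, abs_continuous_segment 0 b W) ->
  {ae mu, forall t : R, 0 <= t ->
    exists2 D, is_derive t (1 : R) W D & sqn (p t) <= D} ->
  (forall t, 0 <= t -> W t <= C) ->
  tends_to_zero p.
Proof.
move=> acp dp acW dW WC.
have [c c0 Hc] := quad_bound F.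
have acW' s t : 0 <= s -> abs_continuous_segment s t W.
  by move=> s0; apply: ac_subsegment (acW t).
have acN s t : 0 <= s -> abs_continuous_segment s t (fun s => quad 1%:M (p s)).
  move=> s0; apply: quad_ac => i; apply: acp => x /=.
  by rewrite !in_itv /= andbT => /andP[/(le_trans s0)].
have Nq x : quad 1%:M (p x) = sqn (p x) by rewrite quad_dotv mul1mx.
have step1 s t : 0 <= s -> s <= t ->
    sqn (p t) <= sqn (p s) + 2 * c * (W t - W s).
  move=> s0 st.
  have := ac_nondecreasing st (acD (acZ (2 * c) (acW' s t s0)) (acZ (-1) (acN s t s0))).
  rewrite !Nq => H; rewrite -subr_ge0.
  have {}H : 2 * c * W s + -1 * sqn (p s) <= 2 * c * W t + -1 * sqn (p t).
    apply: H; move: dp dW; apply: filterS2; first exact: (ae_filter_ringOfSetsType mu).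
    move=> x dx dWx /andP[sx xt].
    have x0 : 0 <= x by exact: le_trans sx.
    have /dx {}dx : `[0, +oo[%classic x by rewrite /= in_itv /= x0.
    have [D dD pD] := dWx x0.
    have dq := is_derive_quad (trmx1 _ _) dx.
    have dE := is_deriveD (is_deriveZ (2 * c) dD) (is_deriveZ (- 1) dq).
    eexists; first exact: dE.
    rewrite /GRing.scale /= mul1mx -quad_dotv.
    have := Hc (p x); rewrite ler_norml => /andP[_ Hs].
    by nra.
  lra.
have step2 eps s t : 0 <= s -> s <= t ->
    (forall x, s <= x -> eps <= sqn (p x)) -> W s + eps * (t - s) <= W t.
  move=> s0 st ep.
  have dl x : is_derive x (1 : R) (fun x : R => - eps * x) (- eps).
    have := is_deriveZ (- eps) (is_derive_id x (1 : R)).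
    by rewrite [_ *: 1]mulr1.
  have acl : abs_continuous_segment s t (fun x => - eps * x).
    by apply: (@C1_ac _ _ _ (fun=> - eps)) => // x; exact: cvg_cst.
  have := ac_nondecreasing st (acD (acW' s t s0) acl) => H.
  have : W s + - eps * s <= W t + - eps * t.
    apply: H; move: dW; apply: filterS; first exact: (ae_filter_ringOfSetsType mu).
    move=> x dWx /andP[sx xt].
    have [D dD pD] := dWx (le_trans s0 sx).
    exists (D + - eps); first exact: (is_deriveD dD (dl x)).
    by have := ep _ sx; lra.
  lra.
(* W is nondecreasing and nearly reaches its supremum at some T0; past T0 there
   is a time at which |p|^2 is small, and it stays small thereafter. *)
pose Sv := [set W t | t in [set t | 0 <= t]].
have hsS : has_sup Sv.
  split; first by exists (W 0); exists 0 => //=.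
  by exists C => _ [t t0 <-]; exact: WC.
have key eta : 0 < eta -> exists2 s, 0 <= s &
    forall t, s <= t -> sqn (p t) <= eta + 2 * c * eta.
  move=> eta0.
  have [_ [T0 /= T00 <-] WT0] := sup_adherent eta0 hsS.
  have [s [sT0 Ns]] : exists s, T0 <= s /\ sqn (p s) < eta.
    apply: contrapT => no.
    have big x : T0 <= x -> eta <= sqn (p x).
      by move=> xT; rewrite leNgt; apply/negP => h; apply: no; exists x.
    have T1 : T0 <= T0 + (C - W T0 + 1) / eta.
      by rewrite lerDl divr_ge0 ?(ltW eta0) //; have := WC _ T00; lra.
    have := step2 eta _ _ T00 T1 big.
    rewrite addrAC subrr add0r mulrC divfK ?gt_eqF // => h.
    by have := WC _ (le_trans T00 T1); lra.
  have s0 := le_trans T00 sT0.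
  exists s => // t st; have t0 := le_trans s0 st.
  have h1 := step1 _ _ s0 st.
  have h2 : W t <= sup Sv by apply: sup_upper_bound => //; exists t.
  have h3 := step1 _ _ T00 sT0.
  have h4 : W T0 <= W s.
    have := step2 0 _ _ T00 sT0; rewrite mul0r addr0; apply => x _; exact: sqn_ge0.
  have : 2 * c * (W t - W s) <= 2 * c * eta by rewrite ler_wpM2l //; lra.
  lra.
move=> i; apply/cvgrPdist_lt => e e0.
pose eta := e ^+ 2 / 2 / (1 + 2 * c).
have c21 : 0 < 1 + 2 * c by lra.
have eta0 : 0 < eta by rewrite !divr_gt0 // exprn_gt0.
have [s s0 H] := key _ eta0.
near=> t.
have st : s <= t by near: t; apply: nbhs_pinfty_ge; exact: num_real.
rewrite sub0r normrN -(ltr_pXn2r (_ : (0 < 2)%N)) ?nnegrE ?normr_ge0 ?(ltW e0) //.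
rewrite real_normK ?num_real //.
apply: le_lt_trans (sqr_le_sqn _ _) _; apply: le_lt_trans (H _ st) _.
have -> : eta + 2 * c * eta = e ^+ 2 / 2.
  by rewrite /eta; field; rewrite gt_eqF.
by rewrite ltr_pdivrMr // ltr_pMr ?exprn_gt0 // ltr1n.
Unshelve. all: by end_near. Qed.

End LinearODE.

(** * Almost everywhere equality, measurability and limits *)

Section VectorFunctions.
Context {R : realType}.
Notation mu := (@lebesgue_measure R).

Lemma ae_exists_itv a b (P : R -> Prop) : a < b ->
  {ae mu, forall t, a < t < b -> P t} -> exists2 t, a < t < b & P t.
Proof.
move=> ab [N [mN N0 bad]]; apply: contrapT => no.
have sub : `]a, b[%classic `<=` N.
  move=> t; rewrite /= in_itv /= => tab; apply: bad => /= /(_ tab) Pt.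
  by apply: no; exists t.
have muab : mu (`]a, b[%classic) = (b - a)%:E.
  by rewrite lebesgue_measure_itv /= lte_fin ab.
have : (mu (`]a, b[%classic) <= mu N)%E by rewrite le_measure ?inE.
rewrite muab [X in (_ <= X)%E](_ : _ = 0%E) // lee_fin; lra.
Qed.

(** Two absolutely continuous functions that agree almost everywhere on a
    nondegenerate segment agree on it. *)
Lemma ac_ae_eq a b (f g : R -> R) : a < b -> abs_continuous_segment a b f ->
  abs_continuous_segment a b g ->
  {ae mu, forall t, a <= t <= b -> f t = g t} ->
  forall t, a <= t <= b -> f t = g t.
Proof.
move=> ab acf acg fg t tab; apply/eqP; rewrite -subr_eq0; apply/negP => /negP h0.
have ach := acD acf (acZ (-1) acg).
have n0 : 0 < `|f t - g t| by rewrite normr_gt0.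
have [d d0 H] := ac_unif_continuous ach n0.
case/andP: (tab) => at' tb.
have lo : Num.max a (t - d) < Num.min b (t + d).
  by rewrite lt_min !gt_max ab /=; apply/andP; split; [lra|apply/andP; split; lra].
have [s] : exists2 s, Num.max a (t - d) < s < Num.min b (t + d) & f s = g s.
  apply: ae_exists_itv => //; move: fg; apply: filterS.
    exact: (ae_filter_ringOfSetsType mu).
  move=> s fgs /andP[]; rewrite gt_max lt_min => /andP[as' _] /andP[sb _].
  by apply: fgs; rewrite (ltW as') ltW.
rewrite gt_max lt_min => /andP[/andP[h1 h2] /andP[h3 h4]] fgs.
have := H t s tab; rewrite (ltW h1) (ltW h3) => /(_ isT).
have -> : `|t - s| < d by rewrite ltr_norml; apply/andP; split; lra.
by move=> /(_ isT); rewrite fgs !mulN1r subrr subr0 ltxx.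
Qed.

Lemma AC_eq_ae a b q (f g : R -> 'cV[R]_q) : a < b ->
  AC `[a, b] f -> AC `[a, b] g -> eq_ae `[a, b] f g ->
  forall t, a <= t <= b -> f t = g t.
Proof.
move=> ab /AC_itvP acf /AC_itvP acg fg t tab; apply/colP => i.
apply: (ac_ae_eq ab (acf i) (acg i) _ tab).
move: fg; apply: filterS; first exact: (ae_filter_ringOfSetsType mu).
by move=> s fgs sab; rewrite fgs //= in_itv.
Qed.

Lemma eq_ae_sub (I J : set R) q (f g : R -> 'cV[R]_q) : J `<=` I ->
  eq_ae I f g -> eq_ae J f g.
Proof.
move=> JI; apply: filterS; first exact: (ae_filter_ringOfSetsType mu).
by move=> t H /JI; exact: H.
Qed.

(** Time intervals are nondegenerate, so the same holds on them. *)
Lemma AC_eq_ae_interval (I : set R) q (f g : R -> 'cV[R]_q) : time_interval I ->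
  AC I f -> AC I g -> eq_ae I f g -> forall t, I t -> f t = g t.
Proof.
move=> tI acf acg fg t It.
have [a [b [ab tab abI]]] : exists a b, [/\ a < b, a <= t <= b & `[a, b] `<=` I].
  case: tI It => [|a|b|a b ab]; rewrite /= ?in_itv /= ?andbT => It.
  - by exists t, (t + 1); split => //; lra.
  - exists t, (t + 1); split; [lra|lra|move=> s /=]; rewrite !in_itv /=; lra.
  - exists (t - 1), t; split; [lra|lra|move=> s /=]; rewrite !in_itv /=; lra.
  - by exists a, b; split.
apply: (AC_eq_ae ab) tab; [exact: AC_sub acf|exact: AC_sub acg|exact: eq_ae_sub fg].
Qed.

Lemma ac_integrable a b (f : R -> R) : abs_continuous_segment a b f ->
  mu.-integrable `[a, b] (EFin \o f).
Proof.
move=> acf; apply: continuous_compact_integrable; first exact: segment_compact.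
exact: ac_continuous.
Qed.

Lemma AC_L1loc q (f : R -> 'cV[R]_q) : AC `[0, +oo[ f -> L1loc `[0, +oo[ f.
Proof.
move=> acf i; split; last by move=> a b ab; apply: ac_integrable; exact: acf.
apply: subspace_continuous_measurable_fun => //.
apply/subspace_continuousP => x; rewrite /= in_itv /= andbT => x0.
apply/cvgrPdist_lt => e e0.
have acx : abs_continuous_segment 0 (x + 1) (fun t => f t i 0).
  by apply: acf; exact: subset_itv_cc0y.
have [d d0 H] := ac_unif_continuous acx e0.
rewrite near_withinE; near=> y; rewrite /= in_itv /= andbT => y0; apply: H.
- by apply/andP; split; [exact: x0|rewrite lerDl].
- apply/andP; split; first exact: y0.
  by near: y; apply: lt_le_nbhsl; rewrite ltrDl.
- by near: y; exact: nbhsx_ballx.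
Unshelve. all: by end_near. Qed.

Lemma measurable_mulmx (D : set R) q e (M : 'M[R]_(e, q)) (x : R -> 'cV[R]_q) :
  (forall i, measurable_fun D (fun t => x t i 0)) ->
  forall i, measurable_fun D (fun t => (M *m x t) i 0).
Proof.
move=> mx i; under eq_fun do rewrite mxE.
by apply: measurable_sum => j; apply: measurable_funM.
Qed.

Lemma measurable_quad (D : set R) q (M : 'M[R]_q) (x : R -> 'cV[R]_q) :
  (forall i, measurable_fun D (fun t => x t i 0)) ->
  measurable_fun D (fun t => quad M (x t)).
Proof.
move=> mx; under eq_fun do rewrite quad_dotv dotvE.
by apply: measurable_sum => i; apply: measurable_funM => //; exact: measurable_mulmx.
Qed.

Lemma continuous_antiderivative (g : R -> R) : continuous g ->
  exists G : R -> R, forall t : R, 0 <= t -> is_derive t (1 : R) G (g t).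
Proof.
(* Starting the integral at -1 makes 0 an interior point. *)
move=> cg; pose G x := (\int[mu]_(t in [set` Interval (BLeft (- 1)) (BRight x)]) g t).
exists G => t t0.
have intg : mu.-integrable [set` Interval (BLeft (- 1)) (BRight (t + 1))] (EFin \o g).
  apply: continuous_compact_integrable; first exact: segment_compact.
  exact: continuous_subspaceT.
have [||D1 D2] := continuous_FTC1 (_ : t < t + 1) intg _ (cg t).
- by rewrite ltrDl.
- by rewrite (@lte_fin R); lra.
- by apply: DeriveDef => //; rewrite -derive1E D2.
Qed.

Lemma tends_to_zero_sqn q (v : R -> 'cV[R]_q) : tends_to_zero v ->
  forall e, 0 < e -> \forall t \near +oo, sqn (v t) < e.
Proof.
move=> v0 e e0.
have : sqn (v t) @[t --> +oo] --> (0 : R).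
  under eq_fun do rewrite sqn_sum.
  have := @cvg_sum_fin R _ (+oo : set_system R) _ q (fun i t => v t i 0 ^+ 2) (fun=> 0).
  rewrite big1 //; apply => i; under eq_fun do rewrite expr2.
  by rewrite -(mulr0 (0 : R)); apply: cvgM; exact: v0.
move=> /cvgrPdist_lt /(_ _ e0); apply: filterS => t.
by rewrite sub0r normrN ger0_norm // sqn_ge0.
Qed.

Lemma tends_to_zero_mulmx q e (M : 'M[R]_(e, q)) (v : R -> 'cV[R]_q) :
  tends_to_zero v -> tends_to_zero (fun t => M *m v t).
Proof.
move=> v0 i; under eq_fun do rewrite mxE.
have := @cvg_sum_fin R _ (+oo : set_system R) _ q
  (fun j t => M i j * v t j 0) (fun=> 0).
rewrite big1 //; apply => j.
by rewrite -(mulr0 (M i j)); apply: cvgMr; exact: v0.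
Qed.

Lemma tends_to_zero_near_eq q (v w : R -> 'cV[R]_q) :
  (forall t, 0 <= t -> v t = w t) -> tends_to_zero v -> tends_to_zero w.
Proof.
move=> vw v0 i; apply: cvg_trans (v0 i); apply: near_eq_cvg.
near=> t; rewrite vw //; near: t; apply: nbhs_pinfty_ge; exact: num_real.
Unshelve. all: by end_near. Qed.

(** * Upper limits at infinity *)

Lemma limf_esup_pinfty_le (f : R -> \bar R) (a : R) :
  (forall e, 0 < e -> \forall t \near +oo, (f t <= (a + e)%:E)%E) ->
  (limf_esup f (pinfty_nbhs R) <= a%:E)%E.
Proof.
move=> fa; apply/lee_addgt0Pr => e e0.
have nf := fa _ e0.
apply: le_trans (_ : ereal_sup (f @` [set t | (f t <= (a + e)%:E)%E]) <= _)%E.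
  by apply: ereal_inf_lbound; exists [set t | (f t <= (a + e)%:E)%E].
by apply: ge_ereal_sup => _ [t ft <-]; rewrite -EFinD.
Qed.

Lemma limf_esup_pinfty_ge (f : R -> \bar R) (a : R) :
  (forall e, 0 < e -> \forall t \near +oo, ((a - e)%:E <= f t)%E) ->
  (a%:E <= limf_esup f (pinfty_nbhs R))%E.
Proof.
move=> fa; apply: le_ereal_inf_tmp => _ [A FA <-].
apply/lee_subgt0Pr => e e0.
have [t [At ft]] := filter_ex (filterI FA (fa _ e0)).
by apply: (le_trans ft); apply: ereal_sup_ubound; exists t.
Qed.

Lemma limf_esup_pinfty_lty (f : R -> \bar R) :
  (limf_esup f (pinfty_nbhs R) < +oo)%E ->
  exists C : R, \forall t \near +oo, (f t <= C%:E)%E.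
Proof.
move=> /ereal_inf_lt[_ [A FA <-]] supA.
have [C supC] : exists C : R, (ereal_sup (f @` A) <= C%:E)%E.
  case: (ereal_sup _) supA => [C _|//|_]; last by exists 0; rewrite leNye.
  by exists C.
exists C; apply: filterS FA => t At; apply: le_trans supC.
by apply: ereal_sup_ubound; exists t.
Qed.

End VectorFunctions.

(** * Block coordinates *)

Section LinearParts.
Context {R : realType}.

Lemma usubmxE (a b e : nat) (X : 'M[R]_(a + b, e)) : usubmx X = row_mx 1%:M 0 *m X.
Proof. by rewrite -[X in RHS]vsubmxK mul_row_col mul1mx mul0mx addr0. Qed.

Lemma dsubmxE (a b e : nat) (X : 'M[R]_(a + b, e)) : dsubmx X = row_mx 0 1%:M *m X.
Proof. by rewrite -[X in RHS]vsubmxK mul_row_col mul1mx mul0mx add0r. Qed.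

Lemma has_derivative_ae_mulmx (I : set R) q e (M : 'M[R]_(e, q))
    (p f : R -> 'cV[R]_q) : has_derivative_ae I p f ->
  has_derivative_ae I (fun t => M *m p t) (fun t => M *m f t).
Proof.
apply: filterS; first exact: (ae_filter_ringOfSetsType lebesgue_measure).
by move=> t dp It i; apply: is_derive_mulmx => j; exact: dp.
Qed.

Lemma AC_col_mx (I : set R) q e (v : R -> 'cV[R]_q) (w : R -> 'cV[R]_e) :
  AC I v -> AC I w -> AC I (fun t => col_mx (v t) (w t)).
Proof.
move=> acv acw i a b ab; under eq_fun do rewrite mxE.
by case: fintype.split => j; [exact: acv|exact: acw].
Qed.

Lemma AC_usubmx (I : set R) q e (p : R -> 'cV[R]_(q + e)) :
  AC I p -> AC I (fun t => usubmx (p t)).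
Proof.
move=> acp.
have -> : (fun t => usubmx (p t)) = (fun t => row_mx 1%:M 0 *m p t).
  by apply/funext => t; rewrite usubmxE.
exact: AC_mulmx.
Qed.

Lemma AC_dsubmx (I : set R) q e (p : R -> 'cV[R]_(q + e)) :
  AC I p -> AC I (fun t => dsubmx (p t)).
Proof.
move=> acp.
have -> : (fun t => dsubmx (p t)) = (fun t => row_mx 0 1%:M *m p t).
  by apply/funext => t; rewrite dsubmxE.
exact: AC_mulmx.
Qed.

Lemma young d (a b : 'cV[R]_d) (th : R) : 0 < th ->
  2 * dotv a b <= th * sqn a + sqn b / th.
Proof.
move=> th0; have := sqn_ge0 (th *: a - b).
rewrite /sqn -scaleN1r !(dotvDl, dotvDr, dotvZl, dotvZr) (dotvC b a).
set x := dotv a a; set y := dotv a b; set w := dotv b b => h.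
rewrite -subr_ge0.
have -> : th * x + w / th - 2 * y =
    (th * (th * x) + -1 * (th * y) + (th * (-1 * y) + -1 * (-1 * w))) / th.
  by field; rewrite gt_eqF.
by apply: divr_ge0; [move: h; lra|exact: ltW].
Qed.

End LinearParts.

(** * The associated system *)

Section AssociatedODE.
Context {R : realType} {c n m k l r : nat}.
Context {E A : 'M[R]_(c, n)} {B : 'M[R]_(c, m)}.
Context {Al : 'M[R]_(l + r)} {Bl : 'M[R]_(l + r, k)}.
Context {Cl : 'M[R]_(n + m, l + r)} {Dl : 'M[R]_(n + m, k)}.
Context {T : 'M[R]_(l + r)}.
Context {Ag : 'M[R]_l} {Bg : 'M[R]_(l, k)}.
Context {Cg : 'M[R]_(n + m, l)} {Dg : 'M[R]_(n + m, k)}.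
Context {A12 : 'M[R]_(l, r)} {A22 : 'M[R]_r} {C2 : 'M[R]_(n + m, r)}.
Context (assoc : associated_ode E A B Al Bl Cl Dl).
Context (Tu : T \in unitmx).
Context (Vg : [set T *m p | p in stabilizability_subspace Al Bl] =
              [set v | dsubmx v = 0]).
Context (TA : T *m Al *m invmx T = block_mx Ag A12 0 A22).
Context (TB : T *m Bl = col_mx Bg 0).
Context (TC : Cl *m invmx T = row_mx Cg C2).
Context (DgE : Dg = Dl).

Local Notation M := (state_map E Cl).
Local Notation Mg := (stabilizable_state_map E Cl T).

Lemma state_mapK : M *m (E *m usubmx Cl) = 1%:M.
Proof.
have [_ _ _ rk _] := assoc.
have [FXF _ _ _] := mp_pinvP (E *m usubmx Cl).
have full : row_full (E *m usubmx Cl) by rewrite /row_full rk.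
by apply: (row_full_inj full); rewrite mulmx1; exact: etrans (mulmxA _ _ _) FXF.
Qed.

Lemma E_output (p : 'cV[R]_(l + r)) (w : 'cV[R]_k) :
  E *m usubmx (Cl *m p + Dl *m w) = E *m usubmx Cl *m p.
Proof.
have [_ _ ED _ _] := assoc.
by rewrite linearD /= -!mul_usub_mx mulmxDr !mulmxA ED mul0mx addr0.
Qed.

Lemma state_map_output (p : 'cV[R]_(l + r)) (w : 'cV[R]_k) :
  M *m (E *m usubmx (Cl *m p + Dl *m w)) = p.
Proof. by rewrite E_output mulmxA state_mapK mul1mx. Qed.

(** A solution of the differential-algebraic equation is an output of the
    associated system, whose state is recovered from [E x] at every time. *)
Lemma dae_state (I : set R) x u : time_interval I -> dae_solution I E A B x u ->
  exists p w, [/\ ode_solution I Al Bl p w,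
    eq_ae I (fun t => col_mx (x t) (u t)) (fun t => Cl *m p t + Dl *m w t),
    forall t, I t -> E *m x t = E *m usubmx Cl *m p t &
    forall t, I t -> p t = M *m (E *m x t)].
Proof.
move=> tI sol; have [_ _ _ _ real] := assoc.
have yB : dae_behavior I E A B (fun t => col_mx (x t) (u t)).
  rewrite /dae_behavior /=.
  under [X in dae_solution _ _ _ _ X]eq_fun do rewrite col_mxKu.
  by under [X in dae_solution _ _ _ _ _ X]eq_fun do rewrite col_mxKd.
have [p [w [odes yae]]] := (real I tI).1 _ yB.
have [acp _ _] := odes; have [_ _ acE _] := sol.
have Ex t : I t -> E *m x t = E *m usubmx Cl *m p t.
  move: t; apply: (AC_eq_ae_interval tI) => //; first exact: AC_mulmx.
  move: yae; apply: filterS; first exact: (ae_filter_ringOfSetsType lebesgue_measure).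
  by move=> t yt It; rewrite -(E_output _ (w t)) -yt // col_mxKu.
exists p, w; split => // t It.
by rewrite (Ex t It) mulmxA state_mapK mul1mx.
Qed.

(** * Coordinates adapted to the stabilizability subspace *)

Lemma T_dynamics (p : 'cV[R]_(l + r)) (w : 'cV[R]_k) :
  T *m (Al *m p + Bl *m w) =
  col_mx (Ag *m usubmx (T *m p) + A12 *m dsubmx (T *m p) + Bg *m w)
         (A22 *m dsubmx (T *m p)).
Proof.
have TAl : T *m Al = block_mx Ag A12 0 A22 *m T.
  by rewrite -TA -mulmxA mulVmx // mulmx1.
rewrite mulmxDr !mulmxA TB TAl -mulmxA -{1}[T *m p]vsubmxK mul_block_col.
by rewrite mul_col_mx mul0mx add0r mul0mx add_col_mx addr0.
Qed.

Lemma T_output (p : 'cV[R]_(l + r)) (w : 'cV[R]_k) :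
  Cl *m p + Dl *m w =
  Cg *m usubmx (T *m p) + C2 *m dsubmx (T *m p) + Dg *m w.
Proof.
have -> : Cl = row_mx Cg C2 *m T by rewrite -TC -mulmxA mulVmx // mulmx1.
by rewrite DgE -mulmxA -[T *m p in LHS]vsubmxK mul_row_col.
Qed.

Lemma ode_solution_coords (I : set R) p w : ode_solution I Al Bl p w ->
  [/\ AC I (fun t => usubmx (T *m p t)), AC I (fun t => dsubmx (T *m p t)),
    has_derivative_ae I (fun t => usubmx (T *m p t))
      (fun t => Ag *m usubmx (T *m p t) + A12 *m dsubmx (T *m p t) + Bg *m w t) &
    has_derivative_ae I (fun t => dsubmx (T *m p t))
      (fun t => A22 *m dsubmx (T *m p t))].
Proof.
move=> [acp _ dp]; split.
- exact/AC_usubmx/AC_mulmx.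
- exact/AC_dsubmx/AC_mulmx.
- under [X in has_derivative_ae _ X]eq_fun do rewrite usubmxE mulmxA.
  have := has_derivative_ae_mulmx (row_mx 1%:M 0 *m T) dp.
  under [X in has_derivative_ae _ _ X -> _]eq_fun do
    rewrite -mulmxA T_dynamics -usubmxE col_mxKu.
  exact.
- under [X in has_derivative_ae _ X]eq_fun do rewrite dsubmxE mulmxA.
  have := has_derivative_ae_mulmx (row_mx 0 1%:M *m T) dp.
  under [X in has_derivative_ae _ _ X -> _]eq_fun do
    rewrite -mulmxA T_dynamics -dsubmxE col_mxKd.
  exact.
Qed.

Lemma coords_ode_solution (I : set R) v q w : AC I v -> AC I q -> L1loc I w ->
  has_derivative_ae I (fun t => col_mx (v t) (q t))
    (fun t => col_mx (Ag *m v t + A12 *m q t + Bg *m w t) (A22 *m q t)) ->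
  ode_solution I Al Bl (fun t => invmx T *m col_mx (v t) (q t)) w.
Proof.
move=> acv acq lw ds; split => //; first exact/AC_mulmx/AC_col_mx.
have := has_derivative_ae_mulmx (invmx T) ds; congr has_derivative_ae.
apply/funext => t; apply: (can_inj (mulKmx Tu)).
by rewrite mulKVmx // T_dynamics mulKVmx // col_mxKu col_mxKd.
Qed.

Lemma stabilizability_subspaceP (p0 : 'cV[R]_(l + r)) :
  stabilizability_subspace Al Bl p0 <-> dsubmx (T *m p0) = 0.
Proof.
split=> [Vp|dp]; first by have : [set v | dsubmx v = 0] (T *m p0)
  by rewrite -Vg; exists p0.
have : [set v | dsubmx v = 0] (T *m p0) by [].
by rewrite -Vg => -[p Vp /(can_inj (mulKmx Tu)) <-].
Qed.

Lemma MgE (z : 'cV[R]_c) : Mg *m z = usubmx (T *m (M *m z)).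
Proof. by rewrite usubmxE /stabilizable_state_map !mulmxA. Qed.

(** In the decoupled coordinates the state is still recovered from the output. *)
Lemma state_map_coords (v : 'cV[R]_l) (q : 'cV[R]_r) (w : 'cV[R]_k) :
  T *m (M *m (E *m usubmx (Cg *m v + C2 *m q + Dg *m w))) = col_mx v q.
Proof.
have := T_output (invmx T *m col_mx v q) w.
rewrite mulKVmx // col_mxKu col_mxKd => <-.
by rewrite state_map_output mulKVmx.
Qed.

Lemma Dl_eq0 : Dl = 0 -> Bl = 0.
Proof.
move=> D0; have [_ [[_ ->]//|rk] _ _ _] := assoc.
move: rk; rewrite D0 mxrank0 => k0; apply/matrixP => i j.
by exfalso; case: j => j; rewrite -k0.
Qed.

Lemma Dg_free : Dg <> 0 -> forall w, Dg *m w = 0 -> w = 0 :> 'cV[R]_k.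
Proof.
move=> Dn0 w; have [_ [[D0 _ _]|rk] _ _ _] := assoc; first by rewrite DgE D0 in Dn0.
have full : row_full Dg by rewrite /row_full DgE rk.
by rewrite -{1}(mulmx0 _ Dg) => /(row_full_inj full).
Qed.

Lemma Bg_eq0 : Dg = 0 -> Bg = 0.
Proof.
move=> D0; have B0 : Bl = 0 by apply: Dl_eq0; rewrite -DgE.
by have := congr1 usubmx TB; rewrite B0 mulmx0 col_mxKu linear0.
Qed.

(** Inputs that are invisible in the output do not act on the state: either [Dg]
    is injective, or it vanishes and so does [Bg]. *)
Lemma Dg_kernel (w : 'cV[R]_k) : Dg *m w = 0 -> Bg *m w = 0.
Proof.
have [D0|/eqP Dn0] := eqVneq Dg 0; first by rewrite Bg_eq0 // mul0mx.
by move=> /Dg_free -> //; rewrite mulmx0.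
Qed.

(** * The Riccati equation *)

Context {Q : 'M[R]_n} {Ru : 'M[R]_m} {P : 'M[R]_l}.
Context (QT : Q^T = Q) (Qpos : posdefmx Q) (RuT : Ru^T = Ru) (Rupos : posdefmx Ru).
Context (PT : P^T = P) (Ppos : posdefmx P).
Local Notation S := (block_mx Q 0 0 Ru).
Local Notation K := (riccati_gain S Bg Cg Dg P).
Local Notation W := (Dg^T *m S *m Dg).
Context (ric : riccati_equation S Ag Bg Cg Dg P).

Lemma quad_S (y : 'cV[R]_(n + m)) :
  quad S y = quad Q (usubmx y) + quad Ru (dsubmx y).
Proof.
rewrite !quad_dotv -{1 2}[y]vsubmxK mul_block_col !mul0mx addr0 add0r.
by rewrite /dotv tr_col_mx mul_row_col mxE.
Qed.

Lemma S_sym : S^T = S.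
Proof. by rewrite tr_block_mx QT RuT !trmx0. Qed.

Lemma S_posdef : posdefmx S.
Proof.
move=> y yn0; rewrite quad_S.
have [u0|un0] := eqVneq (usubmx y) 0.
  have dn0 : dsubmx y != 0.
    by apply: contra_neq yn0 => d0; rewrite -[y]vsubmxK u0 d0 col_mx0.
  by rewrite ltr_wpDl ?posdef_semidef ?Rupos.
by rewrite ltr_pwDl ?posdef_semidef ?Qpos.
Qed.

Lemma W_sym : W^T = W.
Proof. by rewrite !trmx_mul trmxK S_sym mulmxA. Qed.

Lemma W_quad w : quad W w = quad S (Dg *m w).
Proof. by rewrite !quad_dotv -!mulmxA [LHS]dotv_mulmx trmxK. Qed.

Lemma W_semidef : possemidefmx W.
Proof. by move=> w; rewrite W_quad posdef_semidef //; exact: S_posdef. Qed.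

(** This form of the definition of [K] also covers the case [Dg = 0]. *)
Lemma gain_eq : W *m K = Bg^T *m P + Dg^T *m S *m Cg.
Proof.
rewrite /riccati_gain; case: eqP => [D0|Dn0].
  by rewrite D0 (Bg_eq0 D0) !trmx0 !mul0mx addr0.
rewrite mulKVmx //; apply: posdef_unitmx => w wn0; rewrite W_quad.
by apply: S_posdef; apply: contra_neq wn0 => /(Dg_free Dn0).
Qed.

(** Completion of squares: along [v' = Ag v + Bg w] the running cost plus the
    derivative of [v^T P v] is a nonnegative quadratic form in [w + K v]. *)
Lemma completion_of_squares (v : 'cV[R]_l) (w : 'cV[R]_k) :
  2 * dotv v (P *m (Ag *m v + Bg *m w)) + quad S (Cg *m v + Dg *m w) =
  quad W (w + K *m v).
Proof.
have ric' : Cg^T *m S *m Cg + (P *m Ag + Ag^T *m P) = K^T *m W *m K.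
  apply/eqP; rewrite -subr_eq0; apply/eqP/esym; apply: etrans ric _.
  by rewrite addrC addrA.
have e1 : dotv v (K^T *m W *m K *m v) = dotv (K *m v) (W *m (K *m v)).
  by rewrite -!mulmxA dotv_mulmx trmxK.
have e2 : dotv w (W *m (K *m v)) =
    dotv w (Bg^T *m P *m v) + dotv w (Dg^T *m S *m Cg *m v).
  by rewrite -dotvDr -mulmxDl -gain_eq -!mulmxA.
have e3 : dotv (K *m v) (W *m w) = dotv w (W *m (K *m v)).
  by rewrite dotvC [in RHS]dotv_mulmx W_sym.
have f1 : dotv v (P *m (Ag *m v)) = dotv v (Ag^T *m P *m v).
  by rewrite dotv_mulmx PT dotvC -mulmxA [in RHS]dotv_mulmx trmxK.
have f2 : dotv v (P *m (Bg *m w)) = dotv w (Bg^T *m P *m v).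
  by rewrite dotv_mulmx PT dotvC -mulmxA [in RHS]dotv_mulmx trmxK.
have f3 : dotv (Cg *m v) (S *m (Cg *m v)) = dotv v (Cg^T *m S *m Cg *m v).
  by rewrite -!mulmxA [in RHS]dotv_mulmx trmxK.
have f4 : dotv (Dg *m w) (S *m (Cg *m v)) = dotv w (Dg^T *m S *m Cg *m v).
  by rewrite -!mulmxA [in RHS]dotv_mulmx trmxK.
have f5 : dotv (Cg *m v) (S *m (Dg *m w)) = dotv w (Dg^T *m S *m Cg *m v).
  by rewrite dotv_mulmx S_sym dotvC f4.
have f6 : dotv (Dg *m w) (S *m (Dg *m w)) = dotv w (W *m w).
  by rewrite -!mulmxA [in RHS]dotv_mulmx trmxK.
have f7 : 2 * dotv v (P *m (Ag *m v)) =
    dotv v (P *m Ag *m v) + dotv v (Ag^T *m P *m v).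
  by rewrite -mulmxA -f1 mulrDl mul1r.
have f8 : dotv v (K^T *m W *m K *m v) = dotv v (Cg^T *m S *m Cg *m v) +
   (dotv v (P *m Ag *m v) + dotv v (Ag^T *m P *m v)).
  by rewrite -ric' !mulmxDl !dotvDr.
rewrite !quad_dotv !mulmxDr !(dotvDl, dotvDr) mulrDr f7 f2 f3 f4 f5 f6 e3 -e1 e2 f8.
ring.
Qed.

Lemma closed_loop_lyapunov (v : 'cV[R]_l) :
  2 * dotv v (P *m ((Ag - Bg *m K) *m v)) + quad S ((Cg - Dg *m K) *m v) = 0.
Proof.
have := completion_of_squares v (- (K *m v)).
rewrite addNr !mulmxN (mulmxA Bg) (mulmxA Dg) -!mulmxBl => ->.
by rewrite /quad mulmx0 mxE.
Qed.

(** The running cost dominates the state because the state is a linear function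
    of the output. *)
Lemma cost_coercive : exists2 kap, 0 < kap & forall v q w,
  kap * (sqn v + sqn q) <= quad S (Cg *m v + C2 *m q + Dg *m w).
Proof.
have [al al0 Hal] := posdef_coercive S_sym S_posdef.
have [a a0 Ha] := sqn_mulmx_bound (T *m M *m E).
exists (al / a); first by rewrite divr_gt0.
move=> v q w; set y := _ + _ + _.
have Ey : T *m M *m E *m usubmx y = col_mx v q.
  by rewrite -(state_map_coords v q w) -!mulmxA.
have h1 := Ha (usubmx y); rewrite Ey sqn_col_mx in h1.
have h2 : sqn (usubmx y) <= sqn y.
  by rewrite -[y in leRHS]vsubmxK sqn_col_mx lerDl sqn_ge0.
apply: le_trans (Hal y); rewrite -mulrA ler_pM2l // mulrC ler_pdivrMr // mulrC.
by apply: (le_trans h1); rewrite ler_pM2l.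
Qed.

(** * The part of the dynamics outside the stabilizability subspace *)

Local Notation mu := (@lebesgue_measure R).
Local Notation Acl := (Ag - Bg *m K).
Local Notation Ccl := (Cg - Dg *m K).

(** A trajectory of the quotient dynamics with finite energy is zero: with the
    feedback [w = - K v] the whole state would have finite energy, hence tend to
    zero, so that the initial state would be stabilizable. *)
Lemma unstable_part_zero (q : R -> 'cV[R]_r) (G : R -> R) (C : R) :
  (forall t i, is_derive t (1 : R) (fun s => q s i 0) ((A22 *m q t) i 0)) ->
  (forall t : R, 0 <= t -> is_derive t (1 : R) G (sqn (q t))) ->
  (forall t, 0 <= t -> G t <= C) -> q 0 = 0.
Proof.
move=> dq dG GC.
pose F : 'M[R]_(l + r) := block_mx Acl A12 0 A22.
have [s s0 ds] := linear_ode_exists F (col_mx 0 (q 0)).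
pose v t := usubmx (s t); pose d t := dsubmx (s t).
have FE t : F *m s t = col_mx (Acl *m v t + A12 *m d t) (A22 *m d t).
  by rewrite -[s t]vsubmxK mul_block_col mul0mx add0r.
have dv t i : is_derive t (1 : R) (fun s => v s i 0) ((Acl *m v t + A12 *m d t) i 0).
  have -> : (fun s => v s i 0) = (fun t => (row_mx 1%:M 0 *m s t) i 0).
    by apply/funext => t'; rewrite /v usubmxE.
  have <- : row_mx 1%:M 0 *m (F *m s t) = Acl *m v t + A12 *m d t.
    by rewrite -usubmxE FE col_mxKu.
  exact: is_derive_mulmx.
have dd t i : is_derive t (1 : R) (fun s => d s i 0) ((A22 *m d t) i 0).
  have -> : (fun s => d s i 0) = (fun t => (row_mx 0 1%:M *m s t) i 0).
    by apply/funext => t'; rewrite /d dsubmxE.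
  have <- : row_mx 0 1%:M *m (F *m s t) = A22 *m d t by rewrite -dsubmxE FE col_mxKd.
  exact: is_derive_mulmx.
have dE t : 0 <= t -> d t = q t.
  move=> t0.
  have [acd dd'] := linear_ode_AC `[0, t] dd.
  have [acq dq'] := linear_ode_AC `[0, t] dq.
  apply: (linear_ode_unique acd dd' acq dq'); last by rewrite t0 lexx.
  by rewrite /d s0 col_mxKd.
have [acs dsae] := linear_ode_AC `[0, +oo[ ds.
have acv : AC `[0, +oo[ v by exact: AC_usubmx.
have acd : AC `[0, +oo[ d by exact: AC_dsubmx.
have [kap kap0 Hkap] := cost_coercive.
have [a a0 Ha] := sqn_mulmx_bound (P *m A12).
have s_to0 : tends_to_zero s.
  (* By Young's inequality V' <= - (kap / 2) |v|^2 + (2 a / kap) |q|^2, so the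
     derivative of W is at least |v|^2 + |q|^2. *)
  pose W t := 2 / kap * (- 1 * quad P (v t)) + (4 * a / kap ^+ 2 + 1) * G t.
  apply: (@linear_ode_L2_tends_to_zero _ _ F s W
    ((4 * a / kap ^+ 2 + 1) * C) acs dsae).
  - move=> b; apply: acD; apply: acZ.
      apply: acZ; apply: quad_ac => i; apply: acv; exact: subset_itv_cc0y.
    apply: (@C1_ac _ _ _ _ (fun t => sqn (q t))) => [t /andP[t0 _]|]; first exact: dG.
    move=> t; have := is_derive_quad (trmx1 _ _) (dq t).
    under eq_fun do rewrite quad_dotv mul1mx.
    exact: is_derive_continuous.
  - apply: aeW => t t0.
    have dV := is_derive_quad PT (dv t).
    have dW := is_deriveD (is_deriveZ (2 / kap) (is_deriveZ (- 1) dV))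
      (is_deriveZ (4 * a / kap ^+ 2 + 1) (dG t t0)).
    eexists; first exact: dW.
    rewrite /GRing.scale /= -[s t]vsubmxK sqn_col_mx -/(v t) -/(d t) (dE t t0).
    rewrite mulmxDr dotvDr.
    have lyap := closed_loop_lyapunov (v t).
    have := Hkap (v t) 0 (- (K *m v t)).
    rewrite mulmx0 addr0 mulmxN (mulmxA Dg) -mulmxBl [sqn 0]/sqn dotvE big1; last first.
      by move=> i _; rewrite mxE mul0r.
    rewrite addr0 => Hv.
    have k2 : 0 < kap / 2 by rewrite divr_gt0.
    have h2 := young (v t) (P *m (A12 *m q t)) k2.
    have h1 := Ha (q t); rewrite -mulmxA in h1.
    move: lyap Hv h1 h2.
    set cross := dotv (v t) (P *m (A12 *m q t)).
    set drift := dotv (v t) (P *m (_ *m v t)).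
    set z2 := sqn (P *m _); set sq := sqn (q t); set sv := sqn (v t).
    set run := quad _ _ => lyap Hv h1 h2.
    have h3 : z2 / (kap / 2) <= a * sq / (kap / 2) by rewrite ler_pM2r ?invr_gt0.
    have h4 : kap / 2 * sv - a * sq / (kap / 2) <= - (2 * (drift + cross)) by lra.
    have := ler_wpM2l (_ : 0 <= 2 / kap) h4.
    rewrite divr_ge0 ?(ltW kap0) // => /(_ isT).
    have -> : 2 / kap * (kap / 2 * sv - a * sq / (kap / 2)) =
       sv - 4 * a / kap ^+ 2 * sq by field; rewrite gt_eqF.
    lra.
  - move=> t t0; rewrite /W.
    have h1 : 0 <= quad P (v t) by exact: posdef_semidef.
    have h2 : (4 * a / kap ^+ 2 + 1) * G t <= (4 * a / kap ^+ 2 + 1) * C.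
      rewrite ler_wpM2l ?GC // addr_ge0 // divr_ge0 ?exprn_ge0 ?mulr_ge0 // ltW //.
    have : 0 <= 2 / kap * quad P (v t) by rewrite mulr_ge0 // divr_ge0 // ltW.
    lra.
have : stabilizability_subspace Al Bl (invmx T *m s 0).
  exists (fun t => - K *m v t), (fun t => invmx T *m s t); split => //; last first.
    exact: tends_to_zero_mulmx.
  have -> : (fun t => invmx T *m s t) = (fun t => invmx T *m col_mx (v t) (d t)).
    by apply/funext => t; rewrite vsubmxK.
  apply: coords_ode_solution => //.
    by apply: AC_L1loc; exact: AC_mulmx.
  have := dsae; congr has_derivative_ae; apply/funext => t; first by rewrite vsubmxK.
  by rewrite FE mulNmx mulmxN mulmxBl mulmxA addrAC.
rewrite stabilizability_subspaceP mulKVmx // s0 col_mxKd.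
exact.
Qed.

(** * Costs *)

Lemma L1loc_sub (I J : set R) d (x : R -> 'cV[R]_d) : measurable I ->
  J `<=` I -> L1loc I x -> L1loc J x.
Proof.
move=> mI JI lx i; have [mx ix] := lx i; split; first exact: measurable_funS mx.
by move=> a b ab; apply: ix; exact: subset_trans JI.
Qed.

Lemma dae_solution_sub (I J : set R) x u : measurable I -> J `<=` I ->
  dae_solution I E A B x u -> dae_solution J E A B x u.
Proof.
move=> mI JI [lx lu ac int]; split.
- exact: L1loc_sub lx.
- exact: L1loc_sub lu.
- exact: AC_sub ac.
- by move=> t0 t /JI It0 /JI It; exact: int.
Qed.

Lemma running_cost_ge0 (x : 'cV[R]_n) (u : 'cV[R]_m) : 0 <= quad Q x + quad Ru u.
Proof. by rewrite addr_ge0 // posdef_semidef. Qed.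

(** The running cost as a function of time, when it is finite. *)
Lemma running_cost_primitive b (x : R -> 'cV[R]_n) (u : R -> 'cV[R]_m) :
  L1loc `[0, b] x -> L1loc `[0, b] u ->
  (\int[mu]_(s in `[0%R, b]) (quad Q (x s) + quad Ru (u s))%:E < +oo)%E ->
  exists F, [/\ abs_continuous_segment 0 b F, F 0 = 0,
   {ae mu, forall t, 0 <= t <= b ->
      is_derive t (1 : R) F (quad Q (x t) + quad Ru (u t))} &
   (\int[mu]_(s in `[0%R, b]) (quad Q (x s) + quad Ru (u s))%:E = (F b)%:E)%E].
Proof.
move=> lx lu fin; pose g s := quad Q (x s) + quad Ru (u s).
have mg : measurable_fun `[0, b] g.
  apply: measurable_funD; apply: measurable_quad => i; first by have [] := lx i.
  by have [] := lu i.
have intg : mu.-integrable `[0, b] (EFin \o g).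
  apply/integrableP; split; first exact/measurable_EFinP.
  apply: le_lt_trans fin; rewrite le_eqVlt; apply/orP; left; apply/eqP.
  by apply: eq_integral => s _; rewrite /= ger0_norm // running_cost_ge0.
have [acF dF] := primitive_ac intg.
eexists; split; [exact: acF| |exact: dF|].
  by rewrite /= set_itv1 Rintegral_set1.
rewrite /= (@eq_Rintegral _ _ _ mu _ g); last first.
  by move=> s; rewrite inE => sI; rewrite patchE mem_set.
by rewrite /Rintegral fineK //; exact: integrable_fin_num.
Qed.

Context {Q0 : 'M[R]_c} (Q0pos : possemidefmx Q0).

(** A solution of finite cost on a segment, described by the associated
    system. *)
Lemma dae_cost b x u : 0 < b -> dae_solution `[0, b] E A B x u ->
  (cost E Q Ru Q0 b x u < +oo)%E ->
  exists p w F, [/\ ode_solution `[0, b] Al Bl p w, p 0 = M *m (E *m x 0),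
    abs_continuous_segment 0 b F /\ F 0 = 0,
    {ae mu, forall t, 0 <= t <= b ->
      is_derive t (1 : R) F (quad S (Cl *m p t + Dl *m w t))} &
    cost E Q Ru Q0 b x u = (quad Q0 (E *m x b) + F b)%:E].
Proof.
move=> b0 sol; have [lx lu _ _] := sol.
rewrite /cost => fin.
have intfin : (\int[mu]_(s in `[0%R, b]) (quad Q (x s) + quad Ru (u s))%:E < +oo)%E.
  by rewrite ltey; apply: contraTneq fin => ->; rewrite addey.
have [F [acF F0 dF FE]] := running_cost_primitive lx lu intfin.
have [p [w [odes yae Ex pE]]] := dae_state (TimeSegment b0) sol.
exists p, w, F; split => //.
- by apply: pE; rewrite /= in_itv /= lexx ltW.
- move: dF yae; apply: filterS2; first exact: (ae_filter_ringOfSetsType mu).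
  move=> t dF yt tb; rewrite -yt; last by rewrite /= in_itv.
  by rewrite quad_S col_mxKu col_mxKd; exact: dF.
- by rewrite FE EFinD.
Qed.

(** Along solutions of bounded cost the quotient state has bounded energy, so a
    finite optimal cost forces the initial state to be stabilizable. *)
Lemma finite_cost_stabilizable (z : 'cV[R]_c) :
  (optimal_cost_infinite E A B Q Ru Q0 z < +oo)%E ->
  dsubmx (T *m (M *m z)) = 0 /\ z = E *m usubmx Cl *m (M *m z).
Proof.
move=> /limf_esup_pinfty_lty[C [C0 [_ HC]]].
have sols b : 0 < b -> C0 < b -> exists x u, dae_solution_from `[0, b] E A B z x u /\
    (cost E Q Ru Q0 b x u < (C + 1)%:E)%E.
  move=> b0 /HC => Cb.
  have : (optimal_cost E A B Q Ru Q0 z b < (C + 1)%:E)%E.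
    by apply: le_lt_trans Cb _; rewrite lte_fin ltrDl.
  by move=> /ereal_inf_lt[_ [[x u] /= xu <-] le]; exists x, u.
split; last first.
  pose b := Num.max 0 C0 + 1.
  have b0 : 0 < b by rewrite ltr_pwDr // le_max lexx.
  have bC : C0 < b by rewrite ltr_pwDr // le_max lexx orbT.
  have [x [u [[sol xz] _]]] := sols b b0 bC.
  have [p [w [_ _ Ex pE]]] := dae_state (TimeSegment b0) sol.
  have I0 : `[0, b]%classic 0 by rewrite /= in_itv /= lexx ltW.
  by rewrite -xz -(pE 0 I0) -(Ex 0 I0).
have [q q0 dq] := linear_ode_exists A22 (dsubmx (T *m (M *m z))).
rewrite -q0.
have csq : continuous (fun t => sqn (q t)).
  move=> t; have := is_derive_quad (trmx1 _ _) (dq t).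
  under eq_fun do rewrite quad_dotv mul1mx.
  exact: is_derive_continuous.
have [G dG] := continuous_antiderivative csq.
have [kap kap0 Hkap] := cost_coercive.
apply: (@unstable_part_zero q G (G 0 + (C + 1) / kap) dq dG) => t t0.
pose b := Num.max t C0 + 1.
have tb : t < b by rewrite ltr_pwDr // le_max lexx.
have b0 : 0 < b by exact: le_lt_trans tb.
have bC : C0 < b by rewrite ltr_pwDr // le_max lexx orbT.
have [x [u [[sol xz] costC]]] := sols b b0 bC.
have [p [w [F [odes p0 [acF F0] dF costE]]]] :=
  dae_cost b0 sol (lt_le_trans costC (leey _)).
have [_ acd _ dd] := ode_solution_coords odes.
have [acq dq'] := linear_ode_AC `[0, b] dq.
have qE s : 0 <= s <= b -> dsubmx (T *m p s) = q s.
  apply: (linear_ode_unique acd dd acq dq').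
  by rewrite p0 xz q0.
have Fbound : F b <= C + 1.
  have := costC; rewrite costE lte_fin => h; have := Q0pos (E *m x b); lra.
have Fmono : F t <= F b.
  apply: ac_nondecreasing; [exact: ltW|exact: ac_subsegment acF|].
  move: dF; apply: filterS; first exact: (ae_filter_ringOfSetsType mu).
  move=> s dF /andP[ts sb]; eexists; first by apply: dF; rewrite sb (le_trans t0).
  by rewrite posdef_semidef //; exact: S_posdef.
have acG : abs_continuous_segment 0 t G.
  by apply: (@C1_ac _ _ _ _ (fun t => sqn (q t))) => // s /andP[s0 _]; exact: dG.
have acF' : abs_continuous_segment 0 t F by apply: ac_subsegment acF => //; exact: ltW.
have : F 0 + - kap * G 0 <= F t + - kap * G t.
  apply: (ac_nondecreasing t0 (acD acF' (acZ (- kap) acG))).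
  move: dF; apply: filterS; first exact: (ae_filter_ringOfSetsType mu).
  move=> s dF /andP[s0 st].
  have sb : 0 <= s <= b by rewrite s0 (le_trans st) // ltW.
  have dFG := is_deriveD (dF sb) (is_deriveZ (- kap) (dG s s0)).
  eexists; first exact: dFG.
  rewrite /GRing.scale /= T_output qE //.
  have := Hkap (usubmx (T *m p s)) (q s) (w s).
  have : 0 <= kap * sqn (usubmx (T *m p s)) by rewrite mulr_ge0 ?sqn_ge0 // ltW.
  lra.
rewrite F0 => h; rewrite -lerBlDl ler_pdivlMr //; lra.
Qed.

(** On a long horizon either the cost is large or the state comes close to zero at
    some time [tau], and the cost up to [tau] is at least the decrease of
    [v^T P v]. *)
Lemma cost_lower_bound (z : 'cV[R]_c) : dsubmx (T *m (M *m z)) = 0 ->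
  forall e, 0 < e -> exists b0 : R, forall b, b0 < b -> forall x u,
    dae_solution_from `[0, b] E A B z x u ->
    ((quad P (Mg *m z) - e)%:E <= cost E Q Ru Q0 b x u)%E.
Proof.
move=> dz0 e e0.
have [kap kap0 Hkap] := cost_coercive.
have [a a0 Ha] := quad_bound P.
set V0 := quad P (Mg *m z).
have V00 : 0 <= V0 by exact: posdef_semidef.
(* As long as V >= e, the running cost is at least this rate. *)
pose rate := kap * e / a.
have rate0 : 0 < rate by rewrite divr_gt0 // mulr_gt0.
exists (V0 / rate) => b bV x u [sol xz].
have b0 : 0 < b by apply: le_lt_trans bV; rewrite divr_ge0 // ltW.
have [//|costlt] := leP (V0 - e)%:E (cost E Q Ru Q0 b x u).
have [p [w [F [odes p0 [acF F0] dF costE]]]] :=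
  dae_cost b0 sol (lt_le_trans costlt (leey _)).
exfalso; move: costlt; rewrite costE lte_fin => costlt.
have [acv acd dv dd] := ode_solution_coords odes.
have d0 s : 0 <= s <= b -> dsubmx (T *m p s) = 0.
  by apply: (linear_ode_zero acd dd); rewrite p0 xz.
pose v s := usubmx (T *m p s).
have v0 : v 0 = Mg *m z by rewrite MgE /v p0 xz.
have acV : abs_continuous_segment 0 b (fun s => quad P (v s)).
  by apply: quad_ac => i; move/AC_itvP: acv; apply.
have dFV : {ae mu, forall s, 0 <= s <= b ->
    is_derive s (1 : R) F (quad S (Cg *m v s + Dg *m w s)) /\
    is_derive s (1 : R) (fun s => quad P (v s))
      (2 * dotv (v s) (P *m (Ag *m v s + Bg *m w s)))}.
  move: dF dv; apply: filterS2; first exact: (ae_filter_ringOfSetsType mu).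
  move=> s dF dv sb; split.
    by have := dF sb; rewrite T_output d0 // mulmx0 addr0.
  apply: is_derive_quad => // i.
  have sI : `[0, b]%classic s by rewrite /= in_itv.
  by have := dv sI i; rewrite d0 // mulmx0 addr0.
have Spos := posdef_semidef S_posdef.
have Qx := Q0pos (E *m x b).
have Fmono s : 0 <= s <= b -> F s <= F b.
  move=> /andP[s0 sb]; apply: ac_nondecreasing sb (ac_subsegment s0 (lexx b) acF) _.
  move: dFV; apply: filterS; first exact: (ae_filter_ringOfSetsType mu).
  move=> t dFV /andP[st tb]; have [|dF' _] := dFV; first by rewrite tb (le_trans s0).
  by eexists; [exact: dF'|exact: Spos].
have [tau tau0b Vtau] : exists2 tau, 0 <= tau <= b & quad P (v tau) < e.
  apply: contrapT => no.
  have Ve s : 0 <= s <= b -> e <= quad P (v s).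
    by move=> sb; rewrite leNgt; apply/negP => h; apply: no; exists s.
  have : F 0 + - rate * 0 <= F b + - rate * b.
    apply: (ac_nondecreasing (ltW b0) (acD acF (acZ (- rate) (ac_id 0 b)))).
    move: dFV; apply: filterS; first exact: (ae_filter_ringOfSetsType mu).
    move=> s dFV sb; have [dF' _] := dFV sb.
    have dFl := is_deriveD dF' (is_deriveZ (- rate) (is_derive_id s (1 : R))).
    eexists; first exact: dFl.
    rewrite /GRing.scale /= mulr1.
    have := Hkap (v s) 0 (w s); rewrite mulmx0 addr0.
    have -> : sqn (0 : 'cV[R]_r) = 0 by rewrite /sqn /dotv mulmx0 mxE.
    rewrite addr0 => h1.
    have h2 : e <= a * sqn (v s) := le_trans (Ve s sb) (le_trans (ler_norm _) (Ha _)).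
    have : rate <= kap * sqn (v s).
      by rewrite /rate ler_pdivrMr // -mulrA ler_pM2l // mulrC.
    lra.
  rewrite F0 mulr0 addr0 mulNr subr_ge0 => h.
  move: bV; rewrite ltr_pdivrMr // mulrC; lra.
have /andP[tau0 taub] := tau0b.
have : F 0 + quad P (v 0) <= F tau + quad P (v tau).
  apply: (ac_nondecreasing tau0
    (acD (ac_subsegment (lexx 0) taub acF) (ac_subsegment (lexx 0) taub acV))).
  move: dFV; apply: filterS; first exact: (ae_filter_ringOfSetsType mu).
  move=> s dFV /andP[s0 st]; have [|dF' dV] := dFV; first by rewrite s0 (le_trans st).
  eexists; first exact: (is_deriveD dF' dV).
  by rewrite addrC completion_of_squares W_semidef.
rewrite F0 v0 -/V0; have := Fmono tau tau0b; lra.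
Qed.

(** * The closed loop *)

Section ClosedLoop.
Context {v : R -> 'cV[R]_l} {v0 : 'cV[R]_l} (vfree : free_trajectory Acl v0 v).

Local Notation xs := (fun t => usubmx (Ccl *m v t)).
Local Notation us := (fun t => dsubmx (Ccl *m v t)).

Let acv : AC `[0, +oo[ v. Proof. by case: vfree. Qed.
Let dv : has_derivative_ae `[0, +oo[ v (fun t => Acl *m v t).
Proof. by case: vfree. Qed.

Lemma closed_loop_ac b i : abs_continuous_segment 0 b (fun t => v t i 0).
Proof. by apply: acv; exact: subset_itv_cc0y. Qed.

Lemma closed_loop_coercive : exists2 kap, 0 < kap &
  forall w : 'cV[R]_l, kap * sqn w <= quad S (Ccl *m w).
Proof.
have [kap kap0 Hkap] := cost_coercive; exists kap => // w.
have := Hkap w 0 (- (K *m w)).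
rewrite mulmx0 addr0 mulmxN (mulmxA Dg) -mulmxBl.
have -> : sqn (0 : 'cV[R]_r) = 0 by rewrite /sqn /dotv mulmx0 mxE.
by rewrite addr0.
Qed.

Lemma closed_loop_to_zero : tends_to_zero v.
Proof.
have [kap kap0 Hkap] := closed_loop_coercive.
pose W t := - kap^-1 * quad P (v t).
apply: (@linear_ode_L2_tends_to_zero _ _ Acl v W 0 acv dv).
- by move=> b; apply: acZ; apply: quad_ac => i; exact: closed_loop_ac.
- move: dv; apply: filterS; first exact: (ae_filter_ringOfSetsType mu).
  move=> t dvt t0; have tI : `[0, +oo[%classic t by rewrite /= in_itv /= t0.
  have dV := is_deriveZ (- kap^-1) (is_derive_quad PT (dvt tI)).
  eexists; first exact: dV.
  rewrite /GRing.scale /=; have lyap := closed_loop_lyapunov (v t).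
  have -> : 2 * dotv (v t) (P *m (Acl *m v t)) = - quad S (Ccl *m v t) by lra.
  by rewrite mulrNN mulrC ler_pdivlMr // mulrC.
- move=> t _; rewrite /W mulNr oppr_le0 mulr_ge0 ?invr_ge0 ?(ltW kap0) //.
  exact: posdef_semidef.
Qed.

Lemma closed_loop_output_L1loc b : L1loc `[0, b] xs /\ L1loc `[0, b] us.
Proof.
have sub := @subset_itv_cc0y R b.
by split; apply: (L1loc_sub (measurable_itv _) sub); apply: AC_L1loc;
  [apply: AC_usubmx|apply: AC_dsubmx]; exact: AC_mulmx.
Qed.

(** The optimal feedback makes the square in the completion of squares vanish,
    so its running cost is the decrease of [v^T P v]. *)
Lemma closed_loop_cost b : 0 <= b ->
  cost E Q Ru Q0 b xs us =
  (quad Q0 (E *m xs b) + (quad P v0 - quad P (v b)))%:E.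
Proof.
move=> b0; have [lx lu] := closed_loop_output_L1loc b.
have runE t : quad Q (xs t) + quad Ru (us t) = quad (Ccl^T *m S *m Ccl) (v t).
  by rewrite -quad_S !quad_dotv -!mulmxA [RHS]dotv_mulmx trmxK.
have fin : (\int[mu]_(s in `[0%R, b]) (quad Q (xs s) + quad Ru (us s))%:E < +oo)%E.
  have -> : (fun s => (quad Q (xs s) + quad Ru (us s))%:E) =
      EFin \o (fun s => quad (Ccl^T *m S *m Ccl) (v s)).
    by apply/funext => s; rewrite /= -runE.
  have intg : mu.-integrable `[0, b]
      (EFin \o (fun s => quad (Ccl^T *m S *m Ccl) (v s))).
    by apply: ac_integrable; apply: quad_ac => i; exact: closed_loop_ac.
  have : (\int[mu]_(s in `[0%R, b])
      (EFin \o (fun s => quad (Ccl^T *m S *m Ccl) (v s))) s \is a fin_num)%E.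
    exact: integrable_fin_num.
  by rewrite fin_numE ltey => /andP[].
have [F [acF F0 dF FE]] := running_cost_primitive lx lu fin.
have [_ _ vv0] := vfree.
have acV : abs_continuous_segment 0 b (fun t => quad P (v t)).
  by apply: quad_ac => i; exact: closed_loop_ac.
have dFV : {ae mu, forall t, 0 <= t <= b ->
    is_derive t (1 : R) (fun t => F t + quad P (v t)) 0}.
  move: dF dv; apply: filterS2; first exact: (ae_filter_ringOfSetsType mu).
  move=> t dFt dvt tb; have tI : `[0, +oo[%classic t.
    by rewrite /= in_itv /= andbT; case/andP: tb.
  have dS := is_deriveD (dFt tb) (is_derive_quad PT (dvt tI)).
  have e0 : quad Q (xs t) + quad Ru (us t) +
      2 * dotv (v t) (P *m (Acl *m v t)) = 0.
    by rewrite -quad_S addrC closed_loop_lyapunov.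
  by rewrite e0 in dS.
have FV : F b + quad P (v b) = quad P v0.
  have le1 : F 0 + quad P (v 0) <= F b + quad P (v b).
    apply: (ac_nondecreasing b0 (acD acF acV)).
    move: dFV; apply: filterS; first exact: (ae_filter_ringOfSetsType mu).
    by move=> t d tb; exists 0; [exact: d|].
  have le2 : -1 * (F 0 + quad P (v 0)) <= -1 * (F b + quad P (v b)).
    apply: (ac_nondecreasing b0 (acZ (-1) (acD acF acV))).
    move: dFV; apply: filterS; first exact: (ae_filter_ringOfSetsType mu).
    move=> t d tb; exists 0; last exact: lexx.
    have := is_deriveZ (-1) (d tb).
    by rewrite [_ *: 0]mulr0.
  by move: le1 le2; rewrite F0 vv0; lra.
by rewrite /cost FE -EFinD; congr (_%:E); lra.
Qed.

Lemma E_closed_loop t : Mg *m (E *m usubmx (Ccl *m v t)) = v t.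
Proof.
rewrite MgE mulmxBl -(mulmxA Dg) -mulmxN.
have := state_map_coords (v t) 0 (- (K *m v t)).
by rewrite mulmx0 addr0 => ->; rewrite col_mxKu.
Qed.

(** The closed loop solves the differential-algebraic equation: it is the output
    of the associated system for the input [- K v], and the initial value of
    [E x] is the prescribed one. *)
Lemma closed_loop_dae_solution (z : 'cV[R]_c) :
  dsubmx (T *m (M *m z)) = 0 -> z = E *m usubmx Cl *m (M *m z) ->
  v0 = Mg *m z -> dae_solution_from `[0, +oo[ E A B z xs us.
Proof.
move=> dz0 zE v0E; have [_ _ vv0] := vfree.
pose w t := - K *m v t.
pose p t := invmx T *m col_mx (v t) (0 : 'cV[R]_r).
have odes : ode_solution `[0, +oo[ Al Bl p w.
  apply: coords_ode_solution => //.
  - by move=> i a b _; exact: ac_cst.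
  - by apply: AC_L1loc; exact: AC_mulmx.
  - have := has_derivative_ae_mulmx (col_mx 1%:M 0 : 'M[R]_(l + r, l)) dv.
    congr has_derivative_ae; apply/funext => t; rewrite mul_col_mx mul1mx mul0mx //.
    by rewrite !mulmx0 addr0 /w mulNmx mulmxN mulmxBl mulmxA.
have outE t : Cl *m p t + Dl *m w t = Ccl *m v t.
  rewrite T_output /p mulKVmx // col_mxKu col_mxKd mulmx0 addr0.
  by rewrite /w mulNmx mulmxN mulmxA mulmxBl.
have [_ _ _ _ real] := assoc.
have [y [yB yae]] := (real _ (TimeFrom 0)).2 _ _ odes.
have {}yae : eq_ae `[0, +oo[ y (fun t => Ccl *m v t).
  by under [X in eq_ae _ _ X]eq_fun do rewrite -outE.
have acEx : AC `[0, +oo[ (fun t => E *m xs t).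
  exact/AC_mulmx/AC_usubmx/AC_mulmx.
have [ly lu acEy inty] := yB.
have Eyx t : 0 <= t -> E *m usubmx (y t) = E *m xs t.
  move=> t0; apply: (AC_eq_ae_interval (TimeFrom 0) acEy acEx); last first.
    by rewrite /= in_itv /= t0.
  move: yae; apply: filterS; first exact: (ae_filter_ringOfSetsType mu).
  by move=> s ys sI; rewrite ys.
have lxs : L1loc `[0, +oo[ xs.
  exact/AC_L1loc/AC_usubmx/AC_mulmx.
have lus : L1loc `[0, +oo[ us.
  exact/AC_L1loc/AC_dsubmx/AC_mulmx.
split; last first.
  rewrite /= [RHS]zE; have := E_output (p 0) (w 0); rewrite outE => ->.
  rewrite /p vv0 v0E MgE -dz0 vsubmxK mulKmx //.
split => // t0 t t0I tI t0t.
have t00 : 0 <= t0 by move: t0I; rewrite /= in_itv /= andbT.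
have t0' : 0 <= t by move: tI; rewrite /= in_itv /= andbT.
rewrite -!Eyx // (inty _ _ t0I tI t0t); congr (_ + _).
apply/colP => i; rewrite !mxE.
have sub : `[t0, t] `<=` `[0, +oo[.
  by move=> s; rewrite /= !in_itv /= andbT => /andP[/(le_trans t00)].
have mAB (x : R -> 'cV[R]_n) (u : R -> 'cV[R]_m) :
    L1loc `[0, +oo[ x -> L1loc `[0, +oo[ u ->
    measurable_fun `[t0, t] (fun s => ((A *m x s + B *m u s) i 0)%:E).
  move=> /(L1loc_sub (measurable_itv _) sub) lx /(L1loc_sub (measurable_itv _) sub) lu'.
  apply/measurable_EFinP.
  have -> : (fun s => (A *m x s + B *m u s) i 0) =
      (fun s => (A *m x s) i 0 + (B *m u s) i 0).
    by apply/funext => s; rewrite mxE.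
  apply: measurable_funD; apply: measurable_mulmx => j.
    by have [] := lx j.
  by have [] := lu' j.
congr fine; apply: ae_eq_integral => //; [exact: mAB|exact: mAB|].
move: yae; apply: filterS; first exact: (ae_filter_ringOfSetsType mu).
by move=> s ys /sub sI; rewrite ys.
Qed.

(** Uniqueness: if [(x, u)] is the prescribed function of [E x] almost
    everywhere, then the input of the associated system is the feedback up to the
    kernel of [Dg], which [Bg] annihilates. *)
Lemma closed_loop_unique (z : 'cV[R]_c) x u : dsubmx (T *m (M *m z)) = 0 ->
  v0 = Mg *m z -> dae_solution_from `[0, +oo[ E A B z x u ->
  eq_ae `[0, +oo[ (fun t => col_mx (x t) (u t)) (fun t => Ccl *m (Mg *m (E *m x t))) ->
  eq_ae `[0, +oo[ x xs /\ eq_ae `[0, +oo[ u us.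
Proof.
move=> dz0 v0E [sol xz] fb.
have [p [w [odes yae Ex pE]]] := dae_state (TimeFrom 0) sol.
have [acpv acpd dpv dpd] := ode_solution_coords odes.
pose pv t := usubmx (T *m p t).
have I0 : `[0, +oo[%classic (0 : R) by rewrite /= in_itv /= lexx.
have p0 : p 0 = M *m z by rewrite pE // xz.
have d0 t : 0 <= t -> dsubmx (T *m p t) = 0.
  move=> t0; have sub := @subset_itv_cc0y R t.
  apply: (linear_ode_zero (AC_sub sub acpd) (has_derivative_ae_sub sub dpd)).
    by rewrite p0.
  by rewrite t0 lexx.
have pvE t : 0 <= t -> pv t = Mg *m (E *m x t).
  by move=> t0; rewrite MgE -pE //= in_itv /= t0.
have dpv' : has_derivative_ae `[0, +oo[ pv (fun t => Acl *m pv t).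
  have : {ae mu, forall t, `[0, +oo[%classic t ->
      Bg *m (w t + K *m pv t) = 0}.
    move: fb yae; apply: filterS2; first exact: (ae_filter_ringOfSetsType mu).
    move=> t fbt yt tI; have t0 : 0 <= t by move: tI; rewrite /= in_itv /= andbT.
    apply: Dg_kernel; have := yt tI.
    rewrite (fbt tI) -pvE // T_output d0 // mulmx0 addr0 -/(pv t) mulmxBl.
    by move=> /addrI; rewrite mulmxDr (mulmxA Dg) => <-; rewrite addNr.
  move: dpv; apply: filterS2; first exact: (ae_filter_ringOfSetsType mu).
  move=> t dpt Bt tI i; have t0 : 0 <= t by move: tI; rewrite /= in_itv /= andbT.
  have := dpt tI i; rewrite d0 // mulmx0 addr0.
  suff -> : Acl *m pv t = Ag *m usubmx (T *m p t) + Bg *m w t by [].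
  rewrite mulmxBl -(mulmxA Bg); congr (_ + _).
  by have /eqP := Bt tI; rewrite mulmxDr addr_eq0 => /eqP ->.
have pvv t : 0 <= t -> pv t = v t.
  move=> t0; have sub := @subset_itv_cc0y R t.
  apply: (linear_ode_unique (AC_sub sub acpv) (has_derivative_ae_sub sub dpv')
    (AC_sub sub acv) (has_derivative_ae_sub sub dv)); last by rewrite t0 lexx.
  by have [_ _ ->] := vfree; rewrite v0E MgE p0.
split; move: fb; apply: filterS; try exact: (ae_filter_ringOfSetsType mu).
  move=> t fbt tI; have t0 : 0 <= t by move: tI; rewrite /= in_itv /= andbT.
  by rewrite -pvv // pvE // -fbt // col_mxKu.
move=> t fbt tI; have t0 : 0 <= t by move: tI; rewrite /= in_itv /= andbT.
by rewrite -pvv // pvE // -fbt // col_mxKd.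
Qed.

(** * Optimality *)

Context {z : 'cV[R]_c} (dz0 : dsubmx (T *m (M *m z)) = 0).
Context (zE : z = E *m usubmx Cl *m (M *m z)) (v0E : v0 = Mg *m z).

Lemma closed_loop_cost_le e : 0 < e -> \forall t \near +oo,
  (cost E Q Ru Q0 t xs us <= (quad P v0 + e)%:E)%E.
Proof.
move=> e0.
have [a a0 Ha] := quad_bound ((E *m usubmx Ccl)^T *m Q0 *m (E *m usubmx Ccl)).
have ea : 0 < e / a by rewrite divr_gt0.
have := tends_to_zero_sqn closed_loop_to_zero ea => small.
near=> t.
have t0 : 0 <= t by near: t; apply: nbhs_pinfty_ge; exact: num_real.
rewrite closed_loop_cost // lee_fin.
have Pv : 0 <= quad P (v t) by exact: posdef_semidef.
have : quad Q0 (E *m usubmx (Ccl *m v t)) <= e.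
  have -> : quad Q0 (E *m usubmx (Ccl *m v t)) =
      quad ((E *m usubmx Ccl)^T *m Q0 *m (E *m usubmx Ccl)) (v t).
    rewrite -mul_usub_mx mulmxA !quad_dotv -!(mulmxA _^T).
    by rewrite [RHS]dotv_mulmx trmxK !mulmxA.
  apply: (le_trans (ler_norm _)); apply: (le_trans (Ha _)).
  rewrite mulrC -ler_pdivlMr //; apply: ltW; near: t; exact: small.
lra.
Unshelve. all: by end_near. Qed.

Let sol := closed_loop_dae_solution dz0 zE v0E.

Lemma closed_loop_solution_on b : dae_solution_from `[0, b] E A B z xs us.
Proof.
have [s s0] := sol; split => //.
by apply: dae_solution_sub s => //; exact: subset_itv_cc0y.
Qed.

Lemma closed_loop_cost_infinite : cost_infinite E Q Ru Q0 xs us = (quad P v0)%:E.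
Proof.
apply/eqP; rewrite eq_le; apply/andP; split.
  by apply: limf_esup_pinfty_le => e; exact: closed_loop_cost_le.
apply: limf_esup_pinfty_ge => e e0.
have [b0 H] := cost_lower_bound dz0 e0.
near=> t; rewrite v0E; apply: H; last exact: closed_loop_solution_on.
by near: t; apply: nbhs_pinfty_gt; exact: num_real.
Unshelve. all: by end_near. Qed.

Lemma optimal_cost_infiniteE :
  optimal_cost_infinite E A B Q Ru Q0 z = (quad P v0)%:E.
Proof.
apply/eqP; rewrite eq_le; apply/andP; split.
  apply: limf_esup_pinfty_le => e e0.
  have := closed_loop_cost_le e0; apply: filterS => t; apply: le_trans.
  by apply: ereal_inf_lbound; exists (xs, us) => //; exact: closed_loop_solution_on.
apply: limf_esup_pinfty_ge => e e0.
have [b0 H] := cost_lower_bound dz0 e0.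
near=> t; apply: le_ereal_inf_tmp => _ [[x u] /= xu <-]; rewrite v0E.
apply: H xu.
by near: t; apply: nbhs_pinfty_gt; exact: num_real.
Unshelve. all: by end_near. Qed.

End ClosedLoop.
End AssociatedODE.

(** * The theorem *)

Theorem theorem6 (R : realType) (c n m k l r : nat)
    (E A : 'M[R]_(c, n)) (B : 'M[R]_(c, m))
    (Q : 'M[R]_n) (Ru : 'M[R]_m) (Q0 : 'M[R]_c) (z : 'cV[R]_c)
    (Al : 'M[R]_(l + r)) (Bl : 'M[R]_(l + r, k))
    (Cl : 'M[R]_(n + m, l + r)) (Dl : 'M[R]_(n + m, k))
    (T : 'M[R]_(l + r))
    (Ag : 'M[R]_l) (Bg : 'M[R]_(l, k))
    (Cg : 'M[R]_(n + m, l)) (Dg : 'M[R]_(n + m, k))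
    (P : 'M[R]_l) :
  let S : 'M[R]_(n + m) := block_mx Q 0 0 Ru in
  let Mg : 'M[R]_(l, c) := stabilizable_state_map E Cl T in
  let K : 'M[R]_(k, l) := riccati_gain S Bg Cg Dg P in
  let Kf : 'M[R]_(m, n) := (dsubmx Cg - dsubmx Dg *m K) *m Mg *m E in
  let K1 : 'M[R]_(n + m, n) := (Cg - Dg *m K) *m Mg *m E - col_mx 1%:M 0 in
  let K2 : 'M[R]_(n + m, m) := col_mx 0 (- 1%:M) in
  Q^T = Q -> posdefmx Q ->
  Ru^T = Ru -> posdefmx Ru ->
  Q0^T = Q0 -> possemidefmx Q0 ->
  diff_consistent E A B z ->
  associated_ode E A B Al Bl Cl Dl ->
  stabilizable_ode Al Bl Cl Dl T Ag Bg Cg Dg ->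
  P^T = P -> posdefmx P -> riccati_equation S Ag Bg Cg Dg P ->
  [/\ infinite_horizon_solvable E A B Q Ru Q0 z <->
        behaviorally_stabilizable E A B z,
      behaviorally_stabilizable E A B z <->
        (optimal_cost_infinite E A B Q Ru Q0 z < +oo)%E &
      infinite_horizon_solvable E A B Q Ru Q0 z ->
      (exists v, free_trajectory (Ag - Bg *m K) (Mg *m z) v) /\
      forall v, free_trajectory (Ag - Bg *m K) (Mg *m z) v ->
      let xs := fun t => usubmx ((Cg - Dg *m K) *m v t) in
      let us := fun t => dsubmx ((Cg - Dg *m K) *m v t) in
      [/\ infinite_horizon_solution E A B Q Ru Q0 z xs us,
          optimal_cost_infinite E A B Q Ru Q0 z =
            cost_infinite E Q Ru Q0 xs us /\
          cost_infinite E Q Ru Q0 xs us = (quad P (Mg *m z))%:E,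
          forall t, 0 <= t -> us t = Kf *m xs t,
          controlled_solution_from E A B K1 K2 z xs us &
          forall x u, controlled_solution_from E A B K1 K2 z x u ->
            eq_ae `[0, +oo[ x xs /\ eq_ae `[0, +oo[ u us]].
Proof.
move=> S Mg K Kf K1 K2 QT Qpos RuT Rupos _ Q0pos _ assoc.
case=> Tu Vg [A12 [A22 TA]] TB [[C2 TC] DgE] PT Ppos ric.
pose M := state_map E Cl.
(* Each of the three conditions is equivalent to this one. *)
pose stabilizable := dsubmx (T *m (M *m z)) = 0 /\ z = E *m usubmx Cl *m (M *m z).
have exv v0 : exists v, free_trajectory (Ag - Bg *m K) v0 v.
  have [v vv0 dv] := linear_ode_exists (Ag - Bg *m K) v0.
  by have [acv dvae] := linear_ode_AC `[0, +oo[ dv; exists v.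
have of_beh : behaviorally_stabilizable E A B z -> stabilizable.
  move=> [x [u [[sol xz] x0]]].
  have [p [w [odes yae Ex pE]]] := dae_state assoc (TimeFrom 0) sol.
  have I0 : `[0, +oo[%classic (0 : R) by rewrite /= in_itv /= lexx.
  have p0 : p 0 = M *m z by rewrite pE // xz.
  split; last by rewrite -p0 -Ex // xz.
  apply/(stabilizability_subspaceP Tu Vg); exists w, p; split => //.
  apply: (@tends_to_zero_near_eq _ _ (fun t => M *m (E *m x t))).
    by move=> t t0; rewrite pE //= in_itv /= t0.
  by do 2 apply: tends_to_zero_mulmx.
have of_cost : (optimal_cost_infinite E A B Q Ru Q0 z < +oo)%E -> stabilizable.
  exact: (finite_cost_stabilizable assoc Tu Vg TA TB TC DgE QT Qpos RuT Rupos
    PT Ppos ric Q0pos).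
have main v : stabilizable -> free_trajectory (Ag - Bg *m K) (Mg *m z) v ->
    [/\ dae_solution_from `[0, +oo[ E A B z (fun t => usubmx ((Cg - Dg *m K) *m v t))
          (fun t => dsubmx ((Cg - Dg *m K) *m v t)),
      cost_infinite E Q Ru Q0 (fun t => usubmx ((Cg - Dg *m K) *m v t))
          (fun t => dsubmx ((Cg - Dg *m K) *m v t)) = (quad P (Mg *m z))%:E,
      optimal_cost_infinite E A B Q Ru Q0 z = (quad P (Mg *m z))%:E &
      tends_to_zero v].
  move=> [dz0 zE] vfree; split.
  - exact: (closed_loop_dae_solution assoc Tu TA TB TC DgE vfree dz0 zE erefl).
  - exact: (closed_loop_cost_infinite assoc Tu TA TB TC DgE QT Qpos RuT Rupos
      PT Ppos ric Q0pos vfree dz0 zE erefl).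
  - exact: (optimal_cost_infiniteE assoc Tu TA TB TC DgE QT Qpos RuT Rupos
      PT Ppos ric Q0pos vfree dz0 zE erefl).
  - exact: (closed_loop_to_zero assoc Tu TB TC DgE QT Qpos RuT Rupos
      PT Ppos ric vfree).
have to_beh : stabilizable -> behaviorally_stabilizable E A B z.
  move=> st; have [v vfree] := exv (Mg *m z).
  have [sol _ _ v0] := main v st vfree.
  exists (fun t => usubmx ((Cg - Dg *m K) *m v t)).
  exists (fun t => dsubmx ((Cg - Dg *m K) *m v t)); split => //.
  have -> : (fun t => usubmx ((Cg - Dg *m K) *m v t)) =
      (fun t => usubmx (Cg - Dg *m K) *m v t).
    by apply/funext => t; rewrite mul_usub_mx.
  exact: tends_to_zero_mulmx.
have to_cost : stabilizable -> (optimal_cost_infinite E A B Q Ru Q0 z < +oo)%E.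
  move=> st; have [v vfree] := exv (Mg *m z).
  by have [_ _ -> _] := main v st vfree; rewrite ltry.
have to_inf v : stabilizable -> free_trajectory (Ag - Bg *m K) (Mg *m z) v ->
    infinite_horizon_solution E A B Q Ru Q0 z
      (fun t => usubmx ((Cg - Dg *m K) *m v t))
      (fun t => dsubmx ((Cg - Dg *m K) *m v t)).
  move=> st vfree; have [sol ci oc _] := main v st vfree.
  by split => //; [rewrite ci oc|exact: to_cost].
have of_inf : infinite_horizon_solvable E A B Q Ru Q0 z -> stabilizable.
  by move=> [x [u [_ _ fin]]]; exact: of_cost.
split.
- split=> [/of_inf/to_beh //|/of_beh st].
  have [v vfree] := exv (Mg *m z).
  by do 2 eexists; exact: to_inf st vfree.
- by split=> [/of_beh/to_cost|/of_cost/to_beh].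
move=> /of_inf st; split; first exact: exv.
move=> v vfree xs us; have [sol ci oc _] := main v st vfree.
have EE t : Mg *m (E *m xs t) = v t by exact: (E_closed_loop assoc Tu TC DgE).
(* The control law K1 x + K2 u = 0 says that (x, u) is the closed-loop output
   at the state Mg E x. *)
have lawE (x : 'cV[R]_n) (u : 'cV[R]_m) :
    K1 *m x + K2 *m u = (Cg - Dg *m K) *m (Mg *m (E *m x)) - col_mx x u.
  rewrite /K1 /K2 mulmxBl !mulmxA -addrA; congr (_ + _).
  rewrite !mul_col_mx !mul0mx mul1mx mulNmx mul1mx opp_col_mx add_col_mx.
  by rewrite opp_col_mx oppr0 addr0 add0r.
split.
- exact: to_inf.
- by rewrite ci oc.
- move=> t t0; rewrite /us /Kf -2!mulmxA EE -mul_dsub_mx.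
  by rewrite linearB /= -mul_dsub_mx.
- split => //; apply: aeW => t tI.
  by rewrite lawE EE vsubmxK subrr.
- move=> x u [sol' law]; have [dz0 zE] := st.
  apply: (closed_loop_unique assoc Tu TA TB TC DgE vfree dz0 erefl sol').
  move: law; apply: filterS; first exact: (ae_filter_ringOfSetsType lebesgue_measure).
  by move=> t lt tI; apply/esym/eqP; rewrite -subr_eq0 -lawE lt.
Qed.
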